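(* Let $f(n)$ be any positive function such that $f(n)=o(n)$. Then there is a constant $M>0$ such that $$\lim_{n\to\infty}\ \min_{1\le k\le f(n)}\ \mathbb{P}\left(\left|\mathrm{Ave}\left(\mathbf{C}^n_{\mathrm{IGP}}\right)-\frac43\sqrt{\frac{2\log n}{k}}\right|\le M\max\left(\frac1k\sqrt{\frac{\log n}{k}},\ \frac{\log\log n}{\sqrt{\log n}}\right)\right)=1,$$ where the minimum is over integers $k$ and $\mathbf{C}^n_{\mathrm{IGP}}$ is the $k\times k$ submatrix produced by the Incremental Greedy Procedure with parameter $k$ applied to $\mathbf{C}^n$.
   Context: $\mathbf{C}^n$ is an $n\times n$ matrix with i.i.d. standard normal entries, $[n]=\{1,\dots,n\}$. $A_{I,J}$ denotes the submatrix of $A$ with rows $I$ and columns $J$ (a singleton is written as its element), and $\mathrm{Ave}(B)$ is the average of the entries of $B$. The minimum over an empty set of $k$ is taken to be $1$. For $1\le k\le n$ let $P_i^n=\{(i-1)\lfloor n/k\rfloor+1,\ (i-1)\lfloor n/k\rfloor+2,\dots,\ i\lfloor n/k\rfloor\}$ for $i=1,\dots,k$. Incremental Greedy Procedure (IGP) on an $n\times n$ matrix $A$ with parameter $k$: choose $i_1\in P_1^n$ arbitrarily (not depending on the entries of $A$), set $I=\{i_1\}$, $J=\emptyset$. Repeat the following two steps alternately until $|I|=|J|=k$: (1) find the column $j\in P^n_{|I|}$ with $\mathrm{Ave}(A_{I,j})\ge \mathrm{Ave}(A_{I,j'})$ for all $j'\in P^n_{|I|}$, and set $J=J\cup\{j\}$;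 (2) find the row $i\in P^n_{|I|+1}$ with $\mathrm{Ave}(A_{i,J})\ge \mathrm{Ave}(A_{i',J})$ for all $i'\in P^n_{|I|+1}$, and set $I=I\cup\{i\}$. (The procedure stops right after the step (1) that makes $|I|=|J|=k$.) Output $A_{I,J}$. *)

(* Defs.v *)
From HB Require Import structures.
From mathcomp Require Import all_boot all_order all_algebra.
From mathcomp Require Import all_classical all_reals all_analysis.
Set Implicit Arguments.
Unset Strict Implicit.
Unset Printing Implicit Defensive.
Import Order.TTheory GRing.Theory Num.Theory.
Import numFieldNormedType.Exports.
Local Open Scope classical_set_scope.
Local Open Scope ring_scope.

Section RandomMatrix.
Context {R : realType} d (T : measurableType d) (P : probability T R).

Definition mutually_independent (I : finType) (X : I -> {RV P >-> R}) : Prop :=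
  forall (S : {set I}) (B : I -> set R), (forall i, measurable (B i)) ->
    P (\bigcap_(i in [set` S]) (X i @^-1` B i)) =
    (\prod_(i in S) P (X i @^-1` B i))%E.

Definition standard_normal (X : {RV P >-> R}) : Prop :=
  forall B : set R, measurable B -> distribution P X B = normal_prob 0 1 B.

Definition iid_standard_normal_mx n (C : 'I_n -> 'I_n -> {RV P >-> R}) : Prop :=
  mutually_independent (fun ij : 'I_n * 'I_n => C ij.1 ij.2) /\
  forall i j, standard_normal (C i j).

Definition mx_sample n (C : 'I_n -> 'I_n -> {RV P >-> R}) (w : T) : 'M[R]_n :=
  \matrix_(i, j) C i j w.

End RandomMatrix.

Definition Ave (R : realType) n (A : 'M[R]_n) (I J : {set 'I_n}) : R :=
  (\sum_(i in I) \sum_(j in J) A i j) / (#|I| * #|J|)%:R.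

(* The ordinal x stands for the index x + 1 of {1, ..., n}, and blocks are
   numbered from 1: the condition is (l-1)m + 1 <= x + 1 <= lm, m = n %/ k. *)
Definition block (n k l : nat) : {set 'I_n} :=
  [set x : 'I_n | (l.-1 * (n %/ k) < x.+1 <= l * (n %/ k))%N].

Definition singleton_in (T : finType) (S U : {set T}) : Prop :=
  exists2 x, x \in U & S = [set x]%SET.

(* The choice made among several maximizers; the selected index is returned
   as a singleton, so that no default element of 'I_n is needed when n = 0. *)
Definition tie_rule n (sel : {set 'I_n} -> {set 'I_n}) : Prop :=
  forall S : {set 'I_n}, S != finset.set0 -> singleton_in (sel S) S.

Section IGP.
Context {R : realType} (n k : nat) (sel : {set 'I_n} -> {set 'I_n}).
Variable A : 'M[R]_n.

Definition best_columns (I : {set 'I_n}) : {set 'I_n} :=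
  [set j in block n k #|I| |
    [forall j' in block n k #|I|, Ave A I [set j'] <= Ave A I [set j]]]%SET.

Definition best_rows (I J : {set 'I_n}) : {set 'I_n} :=
  [set i in block n k #|I|.+1 |
    [forall i' in block n k #|I|.+1, Ave A [set i'] J <= Ave A [set i] J]]%SET.

Definition column_step (s : {set 'I_n} * {set 'I_n}) :=
  (s.1, s.2 :|: sel (best_columns s.1)).

Definition row_step (s : {set 'I_n} * {set 'I_n}) :=
  (s.1 :|: sel (best_rows s.1 s.2), s.2).

(* I1 is the singleton {i_1}.  Each of the first k - 1 rounds is a column step
   followed by a row step; the last column step makes |I| = |J| = k. *)
Definition IGP (I1 : {set 'I_n}) : {set 'I_n} * {set 'I_n} :=
  column_step (iter k.-1 (row_step \o column_step) (I1, finset.set0)).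

Definition Ave_IGP (I1 : {set 'I_n}) : R := Ave A (IGP I1).1 (IGP I1).2.

End IGP.

(* Main.v *)
(* Number the steps of the procedure.  The column step with |I| = l looks only
   at columns of block l, and the row step at rows of block l + 1, none of whose
   entries has been read before.  Hence, conditionally on the past, each step
   gains sqrt l times the maximum of m = n %/ k independent standard normal
   variables.  Outside an event of probability at most 2 k (m q + p ^ m), with
   q = P(N > hi) and p = P(N < lo), all these maxima lie in [lo, hi], and then
   k^2 Ave lies between lo and hi times the sum of sqrt l over the steps, which
   is 4/3 k^(3/2) + O(sqrt k).  With L = ln n, take lo, hi = -+ 2 sqrt L if
   k >= L^2, where both the average and the target are O(1 / sqrt L), and
   lo, hi = sqrt (2 L) -+ 4 ln L / sqrt L otherwise. *)
Require Import Defs.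
From HB Require Import structures.
From mathcomp Require Import all_boot all_order all_algebra.
From mathcomp Require Import all_classical all_reals all_analysis.
From mathcomp Require Import measurable_realfun ring lra.
Set Implicit Arguments.
Unset Strict Implicit.
Unset Printing Implicit Defensive.
Import Order.TTheory GRing.Theory Num.Theory.
Import numFieldNormedType.Exports.
Local Open Scope classical_set_scope.
Local Open Scope ring_scope.

(** * Independence of disjoint families of variables *)

(** Conditioning on the past uses no conditional probability. The state of the run takes finitely
    many values, so a failure event splits according to that value, and each piece is the
    intersection of an event about entries already read with one about unread entries. The split at
    [L ^+ 2] has two reasons. The maximum of [m] normals is near sqrt (2 ln m), and replacing ln m =
    ln n - ln k + O(1) by ln n costs about ln k / sqrt (ln n); this is within the allowed error only
    if ln k = O(ln L). Conversely sqrt (L / k) <= 1 / sqrt L exactly when k >= L^2, and from there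
    on crude bounds suffice. They are also all that is available near k = n, where a block may have
    a single element. In both regimes the failure probability is at most 4 / L, whatever [k] is, so
    the minimum over [k] costs nothing. *)

Section Indep.
Context {R : realType} d (T : measurableType d) (P : probability T R).

(** Dynkin's pi-lambda argument: the events satisfying the product formula with the fixed [E] form a
    lambda-system, and it contains the pi-system [G]. *)
Lemma indep_sigma_gen (G : set (set T)) (E : set T) :
  setI_closed G -> (forall A, G A -> measurable A) -> measurable E ->
  (forall A, G A -> P (A `&` E) = P A * P E)%E ->
  forall A, <<s G >> A -> P (A `&` E) = (P A * P E)%E.
Proof.
move=> GI Gm mE GE.
have sGm : <<s G >> `<=` measurable.
  by apply: smallest_sub => //; exact: sigma_algebra_measurable.
suff : <<s G >> `<=` [set A | measurable A /\ P (A `&` E) = (P A * P E)%E].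
  by move=> H A /H[].
apply: lambda_system_subset => //; last by move=> A GA; split; [exact: Gm|exact: GE].
apply/dynkin_lambda_system; split => /=.
- by split => //; rewrite setTI probability_setT mul1e.
- move=> B [mB PB]; split; first exact: measurableC.
  have PD : P (E `\` B) = (P E - P (B `&` E))%E.
    by rewrite setIC; apply: measureD => //; rewrite ltey_eq fin_num_measure.
  rewrite setIC -setDE PD PB probability_setC//.
  rewrite -(fineK (fin_num_measure P E mE)) -(fineK (fin_num_measure P B mB)).
  by rewrite -EFinM -!EFinD -EFinM mulrBl mul1r.
- move=> F tF HF; have mF n : measurable (F n) by case: (HF n).
  split; first exact: bigcup_measurable.
  rewrite setI_bigcupl measure_semi_bigcup//; first last.
  - by apply: bigcup_measurable => n _; apply: measurableI.
  - by move: tF; apply: trivIset_setIr.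
  - by move=> n; apply: measurableI.
  rewrite measure_semi_bigcup//; last exact: bigcup_measurable.
  rewrite muleC -(fineK (fin_num_measure P E mE)) -nneseriesZl//.
  apply: eq_eseriesr => n _; rewrite fineK ?fin_num_measure// muleC.
  by case: (HF n).
Qed.

End Indep.

Section IndepFamily.
Context {R : realType} d (T : measurableType d) (P : probability T R).
Context (I : finType) (X : I -> {RV P >-> R}).

(** A pi-system generating the sigma-algebra of the variables indexed by [D], of the very form to
    which [mutually_independent] applies. Depending only on these variables is expressed below as
    measurability for [<<s cylinders D >>]. *)
Definition cylinders (D : {set I}) : set (set T) :=
  [set A | exists2 B : I -> set R, (forall i, measurable (B i)) &
           A = \bigcap_(i in [set` D]) X i @^-1` B i].

Lemma cylinders_setI_closed D : setI_closed (cylinders D).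
Proof.
move=> _ _ [B mB ->] [B' mB' ->]; exists (fun i => B i `&` B' i).
  by move=> i; exact: measurableI.
by rewrite -bigcapI; apply: eq_bigcapr => i _; rewrite preimage_setI.
Qed.

Lemma cylinders_measurable D A : cylinders D A -> measurable A.
Proof.
move=> [B mB ->]; apply: fin_bigcap_measurable; first exact: finite_finset.
by move=> i _; rewrite -[_ @^-1` _]setTI; exact: measurable_funP.
Qed.

Lemma sigma_cylinders_measurable D A : <<s cylinders D >> A -> measurable A.
Proof.
apply: smallest_sub; first exact: sigma_algebra_measurable.
exact: cylinders_measurable.
Qed.

Lemma indep_sigma_cylinders (D1 D2 : {set I}) A1 A2 :
  mutually_independent X -> [disjoint D1 & D2]%B ->
  <<s cylinders D1 >> A1 -> <<s cylinders D2 >> A2 ->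
  P (A1 `&` A2) = (P A1 * P A2)%E.
Proof.
move=> iX D12 sA1 sA2.
have mA2 := sigma_cylinders_measurable sA2.
move: A1 sA1; apply: indep_sigma_gen => //.
- exact: cylinders_setI_closed.
- exact: cylinders_measurable.
move=> A1 cA1; have mA1 := cylinders_measurable cA1.
rewrite setIC muleC; move: A2 sA2 {mA2}; apply: indep_sigma_gen => //.
- exact: cylinders_setI_closed.
- exact: cylinders_measurable.
move=> _ [B2 mB2 ->]; case: cA1 => B1 mB1 ->.
(* After one pi-lambda argument on each side, both events are cylinders. As [D1] and [D2] are
   disjoint, their constraints glue into one family on the union. *)
pose B i := if i \in D1 then B1 i else B2 i.
have mB i : measurable (B i) by rewrite /B; case: ifP.
have E1 i : i \in D1 -> B i = B1 i by rewrite /B => ->.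
have E2 i : i \in D2 -> B i = B2 i.
  by move=> iD2; rewrite /B (disjointFl D12 iD2).
have -> : \bigcap_(i in [set` D2]) X i @^-1` B2 i `&`
          \bigcap_(i in [set` D1]) X i @^-1` B1 i =
          \bigcap_(i in [set` D2 :|: D1]) X i @^-1` B i.
  have -> : [set` D2 :|: D1] = [set` D2] `|` [set` D1].
    by apply/seteqP; split=> i /=; rewrite finset.in_setU => /orP.
  rewrite bigcap_setU; congr (_ `&` _); apply: eq_bigcapr => i /= iD.
    by rewrite E2.
  by rewrite E1.
rewrite iX//.
rewrite (eq_bigl [predU D2 & D1]); last by move=> i; rewrite !inE.
rewrite bigU/=; last by rewrite disjoint_sym.
rewrite !iX//; congr (_ * _)%E; apply: eq_bigr => i iD.
  by rewrite E2.
by rewrite E1.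
Qed.

Lemma measurable_fun_cylinders (D : {set I}) i : i \in D ->
  measurable_fun [set: g_sigma_algebraType (cylinders D)] (X i : _ -> R).
Proof.
move=> iD _ B mB; rewrite setTI; apply: sub_gen_smallest.
exists (fun j => if j == i then B else setT).
  by move=> j; case: ifP.
apply/seteqP; split=> w /=; first by move=> Bw j _ /=; case: eqP => // ->.
by move=> /(_ i iD); rewrite /= eqxx.
Qed.

Lemma sigma_cylindersS (D1 D2 : {set I}) :
  D1 \subset D2 -> <<s cylinders D1 >> `<=` <<s cylinders D2 >>.
Proof.
move=> /fintype.subsetP D12; apply: smallest_sub; first exact: smallest_sigma_algebra.
move=> _ [B mB ->]; apply: sub_gen_smallest.
exists (fun j => if j \in D1 then B j else setT).
  by move=> j; case: ifP.
apply/seteqP; split=> w /= Bw j /= jD; first by case: ifPn => // /Bw.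
by have := Bw j (D12 _ jD); rewrite /= jD.
Qed.

End IndepFamily.

(** * Gaussian sums and tails *)

Section Gaussian.
Context {R : realType}.
Local Notation mu := (@lebesgue_measure R).

(** The Radon-Nikodym derivative agrees almost everywhere with the density, both having the same
    integral over every measurable set. The bound by 1 makes [f] integrable; below, [f] is the
    measure of a section. *)
Lemma integral_normal_prob (m s : R) (f : measurableTypeR R -> \bar R) :
  measurable_fun [set: measurableTypeR R] f -> (forall x, 0 <= f x <= 1)%E ->
  (\int[normal_prob m s]_x f x = \int[mu]_x (f x * (normal_pdf m s x)%:E))%E.
Proof.
move=> mf f01.
have fint : (normal_prob m s).-integrable [set: R] f.
  apply/integrableP; split => //.
  apply: (@le_lt_trans _ _ (\int[normal_prob m s]_x (cst 1 x))%E).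
    apply: ge0_le_integral => //=; first exact: measurableT_comp.
    by move=> x _; have /andP[f0 f1] := f01 x; rewrite gee0_abs.
  by rewrite integral_cst//= mul1e -/(normal_prob m s setT) probability_setT ltry.
have dom := @normal_prob_dominates R m s.
rewrite -(Radon_Nikodym_change_of_variables dom)//=.
apply: ae_eq_integral => //.
- exact: emeasurable_funM.
- have mpdf : measurable_fun [set: measurableTypeR R] (fun x => (normal_pdf m s x)%:E).
    by apply/measurable_EFinP; exact: measurable_normal_pdf.
  exact: (emeasurable_funM mf mpdf).
- apply: ae_eqe_mul2l => /=.
  rewrite Radon_NikodymE//=.
  case: cid => /= h [h1 h2 h3].
  apply: integral_ae_eq => //=.
  + by apply/measurableT_comp =>//; exact: measurable_normal_pdf.
  + by move=> E _ mE; rewrite -h3.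
Qed.

Lemma measurable_translation (x : R) :
  measurable_fun [set: measurableTypeR R]
    ((fun y => x + y) : measurableTypeR R -> measurableTypeR R).
Proof. by apply: measurable_funD => //; exact: measurable_id. Qed.

Lemma ge0_integral_translation (x : R) (f : measurableTypeR R -> \bar R) :
  measurable_fun [set: measurableTypeR R] f -> (forall y, 0 <= f y)%E ->
  (\int[mu]_y f (x + y)%R = \int[mu]_y f y)%E.
Proof.
move=> mf f0.
pose tr_mixin := isMeasurableFun.Build _ _ _ _ _ (measurable_translation x).
pose tr : {mfun measurableTypeR R >-> measurableTypeR R} :=
  HB.pack ((fun y => x + y) : measurableTypeR R -> measurableTypeR R) tr_mixin.
have mutr A : measurable A -> mu A = pushforward mu tr A.
  move=> mA; apply: lebesgue_measure_unique => //= _ [[a b]] _ <-.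
  rewrite /pushforward /=.
  have -> : ((fun y : R => x + y) @^-1` `]a, b]) = `]a - x, b - x]%classic.
    by apply/seteqP; split => y /=; rewrite !in_itv/= ltrBlDl lerBrDl.
  rewrite !lebesgue_measure_itv/= !lte_fin ltrD2r.
  by case: ifP => // _; rewrite -!EFinD; congr EFin; ring.
rewrite [RHS](@eq_measure_integral _ _ _ _ (pushforward mu tr)); last first.
  by move=> A mA _; exact: mutr.
rewrite ge0_integral_pushforward//; exact: measurable_translation.
Qed.

(** Completing the square in [x]. For independent centred normals X and Y of deviations [s] and [t],
    the last factor is the density of X given X + Y = z. *)
Lemma normal_pdf_mul (s t x z : R) : 0 < s -> 0 < t ->
  normal_pdf 0 t (z - x) * normal_pdf 0 s x =
  normal_pdf 0 (Num.sqrt (s ^+ 2 + t ^+ 2)) z *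
  normal_pdf (z * s ^+ 2 / (s ^+ 2 + t ^+ 2))
             (s * t / Num.sqrt (s ^+ 2 + t ^+ 2)) x.
Proof.
move=> s0 t0; set r := Num.sqrt _.
have st0 : 0 < s ^+ 2 + t ^+ 2 by rewrite addr_gt0 ?exprn_gt0.
have r0 : 0 < r by rewrite sqrtr_gt0.
have r2 : r ^+ 2 = s ^+ 2 + t ^+ 2 by rewrite sqr_sqrtr// ltW.
rewrite !normal_pdfE ?gt_eqF ?divr_gt0 ?mulr_gt0// /normal_peak /normal_fun.
rewrite mulrACA [RHS]mulrACA -!expRD -!invfM -!sqrtrM; last 2 first.
- by rewrite mulrn_wge0// mulr_ge0 ?sqr_ge0// pi_ge0.
- by rewrite mulrn_wge0// mulr_ge0 ?sqr_ge0// pi_ge0.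
congr (_ ^-1 * expR _).
  congr Num.sqrt; rewrite exprMn exprVn r2; field; exact: lt0r_neq0.
rewrite !subr0 exprMn exprVn r2 exprMn; field.
by rewrite !lt0r_neq0.
Qed.

End Gaussian.

Section GaussianSum.
Context {R : realType}.
Local Notation mu := (@lebesgue_measure R).

(* [normal_pdf_mul] factors the joint density as the density of the sum times
   a conditional density, which integrates to 1. *)
Lemma normal_prob_conv (s t : R) (B : set (measurableTypeR R)) :
  0 < s -> 0 < t -> measurable B ->
  ((normal_prob 0 s \x normal_prob 0 t)
     [set z : measurableTypeR R * measurableTypeR R | B (z.1 + z.2)%R] =
   normal_prob 0 (Num.sqrt (s ^+ 2 + t ^+ 2)) B)%E.
Proof.
move=> s0 t0 mB.
set E := [set z | _].
have madd : measurable_fun [set: measurableTypeR R * measurableTypeR R]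
    ((fun z => z.1 + z.2) : _ -> measurableTypeR R).
  by apply: measurable_funD.
have mE : measurable E by rewrite -[E]setTI; exact: madd.
(* The joint density of the first variable and the sum, restricted to sums in [B]. Tonelli then
   allows the first variable to be integrated out. *)
pose h (x z : measurableTypeR R) : \bar R :=
  ((\1_B z)%:E * ((normal_pdf 0 t (z - x))%:E * (normal_pdf 0 s x)%:E))%E.
have h0 x z : (0 <= h x z)%E.
  by rewrite /h -!EFinM lee_fin !mulr_ge0 ?normal_pdf_ge0.
have mh : measurable_fun [set: measurableTypeR R * measurableTypeR R]
    (fun xz => h xz.1 xz.2).
  apply: emeasurable_funM.
    apply/measurable_EFinP; apply: (measurableT_comp _ measurable_snd).
    exact: measurable_indic.
  apply: emeasurable_funM; apply/measurable_EFinP.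
    apply: (measurableT_comp (measurable_normal_pdf 0 t)).
    by apply: measurable_funB.
  by apply: (measurableT_comp (measurable_normal_pdf 0 s)).
rewrite /product_measure1 integral_normal_prob; last 2 first.
- exact: measurable_fun_xsection.
- move=> x; rewrite measure_ge0/=; apply: probability_le1.
  exact: measurable_xsection.
transitivity (\int[mu]_x \int[mu]_z h x z)%E.
  apply: eq_integral => x _.
  pose g z : \bar R := ((\1_B z)%:E * (normal_pdf 0 t (z - x))%:E)%E.
  have mg : measurable_fun [set: measurableTypeR R] g.
    apply: emeasurable_funM; first exact/measurable_EFinP/measurable_indic.
    apply/measurable_EFinP; apply: (measurableT_comp (measurable_normal_pdf 0 t)).
    exact: measurable_funB.
  have g0 z : (0 <= g z)%E by rewrite /g -EFinM lee_fin mulr_ge0 ?normal_pdf_ge0.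
  rewrite /=; have -> : normal_prob 0 t (xsection E x) = (\int[mu]_z g z)%E.
    rewrite /normal_prob integral_mkcond -(ge0_integral_translation x mg g0).
    apply: eq_integral => y _; rewrite patchE mem_xsection.
    rewrite /g addrAC subrr add0r indicE.
    have -> : ((x, y) \in E) = (x + y \in B) by apply/idP/idP; rewrite !inE.
    by case: (_ \in B); rewrite ?mul1e ?mul0e.
  have k0 : (0 <= (normal_pdf 0 s x)%:E)%E by rewrite lee_fin normal_pdf_ge0.
  rewrite muleC -(ge0_integralZl mu measurableT mg (fun z _ => g0 z) k0).
  by apply: eq_integral => z _; rewrite /h muleCA [X in (_ * X)%E]muleC.
rewrite (@fubini_tonelli _ _ _ _ _ mu mu (fun xz => h xz.1 xz.2))//=.
rewrite [RHS]/normal_prob [RHS]integral_mkcond/=; apply: eq_integral => z _.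
set r := Num.sqrt _; pose m := z * s ^+ 2 / (s ^+ 2 + t ^+ 2).
rewrite (_ : \int[mu]_x _ = \int[mu]_x (((\1_B z * normal_pdf 0 r z)%:E) *
    (normal_pdf m (s * t / r) x)%:E))%E; last first.
  by apply: eq_integral => x _; rewrite /h -!EFinM normal_pdf_mul// mulrA.
rewrite ge0_integralZl//; last 3 first.
- by apply/measurable_EFinP; exact: measurable_normal_pdf.
- by move=> y _; rewrite lee_fin normal_pdf_ge0.
- by rewrite lee_fin mulr_ge0 ?normal_pdf_ge0.
rewrite integral_normal_pdf mule1 patchE indicE.
by case: (_ \in B); rewrite ?mul1r ?mul0r.
Qed.

(** Independence gives the law of the pair on rectangles, hence identifies it with the product
    measure, to which [normal_prob_conv] applies. *)
Lemma normal_add d (T : measurableType d) (P : probability T R)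
    (X Y : T -> R) (s t : R) :
  0 < s -> 0 < t ->
  measurable_fun [set: T] X -> measurable_fun [set: T] Y ->
  (forall B : set R, measurable B -> P (X @^-1` B) = normal_prob 0 s B) ->
  (forall B : set R, measurable B -> P (Y @^-1` B) = normal_prob 0 t B) ->
  (forall A B : set R, measurable A -> measurable B ->
     P (X @^-1` A `&` Y @^-1` B) = (P (X @^-1` A) * P (Y @^-1` B))%E) ->
  forall B : set R, measurable B ->
    P ((fun w => X w + Y w) @^-1` B) =
    normal_prob 0 (Num.sqrt (s ^+ 2 + t ^+ 2)) B.
Proof.
move=> s0 t0 mX mY PX PY indep B mB; rewrite -normal_prob_conv//.
have mXY : measurable_fun [set: T]
    ((fun w => (X w, Y w)) : T -> measurableTypeR R * measurableTypeR R).
  by apply/measurable_fun_pairP.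
pose XY_mixin := isMeasurableFun.Build _ _ _ _ _ mXY.
pose XY : {mfun T >-> (measurableTypeR R * measurableTypeR R)%type} :=
  HB.pack ((fun w => (X w, Y w)) : T -> measurableTypeR R * measurableTypeR R)
    XY_mixin.
apply/esym.
rewrite (@product_measure_unique _ _ _ _ _ (normal_prob 0 s) (normal_prob 0 t)
  (pushforward P XY))//.
- move=> A A' mA mA'; by have := indep _ _ mA mA'; rewrite PX// PY//.
- rewrite -[X in measurable X]setTI.
  have madd : measurable_fun [set: measurableTypeR R * measurableTypeR R]
    ((fun z => z.1 + z.2) : _ -> measurableTypeR R).
  by apply: measurable_funD.
  exact: madd.
Qed.

End GaussianSum.

Section GaussianTail.
Context {R : realType}.
Local Notation mu := (@lebesgue_measure R).

(* Completing the square, [y] at least [a s] away from 0 gives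
   pdf 0 s y <= exp (- a^2 / 2) * pdf (a s) s y. *)
Lemma normal_prob_tail_le (s a : R) (B : set (measurableTypeR R)) :
  0 < s -> measurable B -> (forall y, B y -> a ^+ 2 * s <= a * y) ->
  (normal_prob 0 s B <= (expR (- (a ^+ 2 / 2)))%:E)%E.
Proof.
move=> s0 mB Ba.
apply: (@le_trans _ _ (\int[mu]_(y in B)
  ((expR (- (a ^+ 2 / 2)))%:E * (normal_pdf (a * s) s y)%:E))%E).
  apply: ge0_le_integral => //=.
  - by move=> y _; rewrite lee_fin normal_pdf_ge0.
  - apply/measurable_EFinP; apply: measurable_funTS.
    exact: measurable_normal_pdf.
  - apply/measurable_EFinP; apply: measurable_funTS; apply: measurable_funM => //.
    exact: measurable_normal_pdf.
  move=> y By; rewrite lee_fin !normal_pdfE ?gt_eqF// mulrCA.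
  rewrite ler_wpM2l ?normal_peak_ge0// /normal_fun -expRD ler_expR.
  have H := Ba _ By; rewrite -subr_ge0.
  suff -> : - (a ^+ 2 / 2) + - (y - a * s) ^+ 2 / (s ^+ 2 *+ 2) -
         - (y - 0) ^+ 2 / (s ^+ 2 *+ 2) = (a * y - a ^+ 2 * s) / s.
    by rewrite divr_ge0 ?subr_ge0// ltW.
  by field; rewrite gt_eqF.
rewrite ge0_integralZl//; last 2 first.
- by apply/measurable_EFinP; apply: measurable_funTS; exact: measurable_normal_pdf.
- by move=> y _; rewrite lee_fin normal_pdf_ge0.
rewrite -[leRHS]mule1 lee_wpmul2l//; exact: (@probability_le1 _ _ _ (normal_prob (a * s) s)).
Qed.

(** The tail contains an interval of length [e * s], on which the density is smallest at the right
    end. The 3 bounds sqrt (2 pi), since pi < 4. *)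
Lemma normal_prob_tail_ge (s a e : R) : 0 < s -> 0 <= a -> 0 <= e ->
  ((e / 3 * expR (- ((a + e) ^+ 2 / 2)))%:E <=
   normal_prob 0 s [set y | (a * s <= y)%R])%E.
Proof.
move=> s0 a0 e0.
apply: (@le_trans _ _ (\int[mu]_(y in `[(a * s)%R, ((a + e) * s)%R])
  (cst ((s * 3)^-1 * expR (- ((a + e) ^+ 2 / 2)))%:E y))%E).
  rewrite integral_cst//= lebesgue_measure_itv/= lte_fin.
  have [ae|] := ltP (a * s) ((a + e) * s); last first.
    rewrite ler_pM2r// -subr_ge0 opprD addrA subrr add0r oppr_ge0 => e0'.
    have -> : e = 0 by apply/eqP; rewrite eq_le e0 e0'.
    by rewrite !mul0r mule0.
  rewrite -EFinD -EFinM lee_fin le_eqVlt; apply/orP; left; apply/eqP.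
  by field; rewrite gt_eqF.
have mpdf : measurable_fun [set: measurableTypeR R] (fun y => (normal_pdf 0 s y)%:E).
  by apply/measurable_EFinP; exact: measurable_normal_pdf.
apply: (@le_trans _ _ (\int[mu]_(y in `[(a * s)%R, ((a + e) * s)%R])
  (normal_pdf 0 s y)%:E)%E).
  apply: ge0_le_integral => //=.
  - by move=> y _; rewrite lee_fin mulr_ge0 ?expR_ge0// invr_ge0 mulr_ge0// ltW.
  - by apply: measurable_funTS.
  move=> y; rewrite in_itv/= => /andP[ay yae]; rewrite lee_fin.
  rewrite normal_pdfE ?gt_eqF//; apply: ler_pM.
  - by rewrite invr_ge0 mulr_ge0// ltW.
  - exact: expR_ge0.
  - rewrite /normal_peak lef_pV2 ?posrE ?mulr_gt0 ?sqrtr_gt0//; last first.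
      by rewrite mulrn_wgt0// mulr_gt0 ?exprn_gt0 ?pi_gt0.
    rewrite -mulrnAr sqrtrM ?sqr_ge0// sqrtr_sqr gtr0_norm// ler_pM2l//.
    have -> : (3 : R) = Num.sqrt (3 ^+ 2) by rewrite sqrtr_sqr ger0_norm.
    rewrite ler_sqrt ?exprn_ge0//.
    have /andP[_ ] := @pihalf_02 R; lra.
  - rewrite /normal_fun ler_expR subr0 mulNr lerN2.
    have y0 : 0 <= y by rewrite (le_trans _ ay)// mulr_ge0// ltW.
    rewrite ler_pdivrMr ?mulrn_wgt0 ?exprn_gt0//.
    have -> : (a + e) ^+ 2 / 2 * (s ^+ 2 *+ 2) = ((a + e) * s) ^+ 2 by field.
    by rewrite ler_pXn2r// nnegrE mulr_ge0// ?addr_ge0// ltW.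
rewrite /normal_prob; apply: ge0_subset_integral => //=.
- by rewrite (_ : [set y | _] = `[a * s, +oo[%classic)//; apply/seteqP; split=> y /=; rewrite in_itv/= andbT.
- exact: measurable_funTS.
- by move=> y _; rewrite lee_fin normal_pdf_ge0.
- by move=> y; rewrite /= in_itv/= => /andP[].
Qed.

End GaussianTail.

Lemma measurable_fun_sum_in (R : realType) d (T : measurableType d)
    (I : finType) (S : {set I}) (x : I -> T -> R) :
  (forall i, i \in S -> measurable_fun [set: T] (x i)) ->
  measurable_fun [set: T] (fun w => \sum_(i in S) x i w).
Proof.
move=> mx; rewrite (_ : (fun w => _) =
    fun w => \sum_(i <- enum S) x i w); last first.
  by apply/funext => w; rewrite big_enum.
have {}mx i : i \in enum S -> measurable_fun [set: T] (x i).
  by rewrite mem_enum; exact: mx.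
elim: (enum S) mx => [|i s IH] mx.
  by rewrite (_ : (fun w => _) = cst 0)//; apply/funext => w; rewrite big_nil.
rewrite (_ : (fun w => _) = fun w => x i w + \sum_(i <- s) x i w); last first.
  by apply/funext => w; rewrite big_cons.
apply: measurable_funD; first by apply: mx; rewrite mem_head.
by apply: IH => j js; apply: mx; rewrite inE js orbT.
Qed.

(** * Sums over disjoint sets of independent normal variables *)

Section IndepLines.
Context {R : realType} d (T : measurableType d) (P : probability T R).
Context (I : finType) (X : I -> {RV P >-> R}).
Hypothesis iX : mutually_independent X.
Hypothesis nX : forall i, standard_normal (X i).

Lemma measurable_sum_cylinders (D S : {set I}) : S \subset D ->
  measurable_fun [set: g_sigma_algebraType (cylinders X D)]
    (fun w => \sum_(i in S) X i w).
Proof.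
move=> /fintype.subsetP SD; apply: measurable_fun_sum_in => i iS.
by apply: measurable_fun_cylinders; exact: SD.
Qed.

Lemma sigma_cylinders_sum (S : {set I}) (B : set R) : measurable B ->
  <<s cylinders X S >> ((fun w => \sum_(i in S) X i w) @^-1` B).
Proof.
move=> mB; have := @measurable_sum_cylinders S S (subxx _) measurableT B mB.
by rewrite setTI.
Qed.

Lemma sum_standard_normal (S : {set I}) : S != finset.set0 ->
  forall B : set R, measurable B ->
  P ((fun w => \sum_(i in S) X i w) @^-1` B) =
  normal_prob 0 (Num.sqrt #|S|%:R) B.
Proof.
move: {2}#|S| (leqnn #|S|) => m; elim: m S => [|m IH] S Sm S0 B mB.
  by move: S0; rewrite -cards_eq0 -leqn0 Sm.
have /set0Pn[i iS] := S0.
(* The induction starts at singletons, because [normal_add] requires both deviations to be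
   positive. *)
have [S1|S1] := eqVneq (S :\ i) finset.set0.
  have -> : S = [set i]%SET by rewrite -(finset.setD1K iS) S1 finset.setU0.
  rewrite cards1 sqrtr1 (_ : (fun w => _) = X i).
    exact: nX.
  by apply/funext => w; rewrite big_set1.
have card_S : #|S| = #|S :\ i|.+1 by rewrite (cardsD1 i) iS.
have Sim : (#|S :\ i| <= m)%N by rewrite -ltnS -card_S.
have Si0 : (0 < #|S :\ i|)%N by rewrite card_gt0.
rewrite (_ : (fun w => _) = fun w => \sum_(j in S :\ i) X j w + X i w); last first.
  by apply/funext => w; rewrite (big_setD1 i)//= addrC.
have -> : Num.sqrt #|S|%:R = Num.sqrt (Num.sqrt #|S :\ i|%:R ^+ 2 + 1 ^+ 2) :> R.
  by rewrite sqr_sqrtr// expr1n card_S -natr1.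
apply: (normal_add (s := Num.sqrt #|S :\ i|%:R) (t := 1)) => //.
- by rewrite sqrtr_gt0 ltr0n.
- move=> _ A mA; rewrite setTI.
  by apply: sigma_cylinders_measurable; exact: sigma_cylinders_sum.
- by move=> A mA; exact: IH.
- by move=> A mA; exact: nX.
- move=> A A' mA mA'.
  apply: (indep_sigma_cylinders (D1 := S :\ i) (D2 := [set i]%SET) iX).
  + by rewrite disjoint_sym disjoints1 !inE eqxx.
  + exact: sigma_cylinders_sum.
  + have := @measurable_fun_cylinders _ _ _ _ _ X [set i]%SET i (finset.set11 _).
    by move=> /(_ measurableT A' mA'); rewrite setTI.
Qed.

(** Events are peeled off one at a time: the one at [j] depends on the variables of [c j], the
    remaining ones on those of the union of the other sets, which is disjoint from [c j]. *)
Lemma indep_bigcap (J : finType) (L : {set J}) (c : J -> {set I})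
    (E : J -> set T) :
  (forall j j', j \in L -> j' \in L -> j != j' -> [disjoint c j & c j']%B) ->
  (forall j, j \in L -> <<s cylinders X (c j) >> (E j)) ->
  P (\bigcap_(j in [set` L]) E j) = (\prod_(j in L) P (E j))%E.
Proof.
move: {2}#|L| (leqnn #|L|) => m; elim: m L => [|m IH] L Lm cdisj sE.
  have -> : L = finset.set0 by apply/eqP; rewrite -cards_eq0 -leqn0.
  rewrite big_set0 (_ : \bigcap_(_ in _) _ = setT) ?probability_setT//.
  by apply/seteqP; split=> // w _ j; rewrite /= inE.
have [->|/set0Pn[j jL]] := eqVneq L finset.set0.
  rewrite big_set0 (_ : \bigcap_(_ in _) _ = setT) ?probability_setT//.
  by apply/seteqP; split=> // w _ j; rewrite /= inE.
have subL j' : j' \in L :\ j -> j' \in L by rewrite inE => /andP[].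
have card_L : #|L| = #|L :\ j|.+1 by rewrite (cardsD1 j) jL.
rewrite (big_setD1 j)//= -IH; last 3 first.
- by rewrite -ltnS -card_L.
- by move=> j1 j2 /subL j1L /subL j2L; exact: cdisj.
- by move=> j1 /subL; exact: sE.
have -> : \bigcap_(j in [set` L]) E j =
    E j `&` \bigcap_(j' in [set` L :\ j]) E j'.
  apply/seteqP; split=> w /=.
    by move=> Ew; split=> [|j' /subL]; exact: Ew.
  move=> [Ejw Ew] j' j'L; have [->//|jj'] := eqVneq j' j.
  by apply: Ew; rewrite /= !inE jj'.
apply: (indep_sigma_cylinders (D1 := c j)
          (D2 := (\bigcup_(j' in L :\ j) c j')%SET) iX).
- apply/bigcup_disjointP => j'; rewrite !inE => /andP[jj' j'L].
  by apply: cdisj; rewrite // eq_sym.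
- exact: sE.
- suff : measurable (\bigcap_(j' in [set` L :\ j]) E j' :
    set (g_sigma_algebraType (cylinders X (\bigcup_(j' in L :\ j) c j')%SET))) by [].
  apply: fin_bigcap_measurable; first exact: finite_finset.
  move=> j' /= j'L; have := sE _ (subL _ j'L).
  by apply: sigma_cylindersS; exact: finset.bigcup_sup.
Qed.

End IndepLines.

(** * Events selected by independent data *)

Section FiniteValued.
Context d (T : measurableType d).

(** Stated on fibres, so that [F] needs no sigma-algebra. [T] will also be instantiated with the
    sub-sigma-algebras generated by cylinders. *)
Definition measurable_fin (F : finType) (g : T -> F) : Prop :=
  forall x, measurable (g @^-1` [set x]).

Lemma measurable_fin_preimage (F : finType) (g : T -> F) (A : set F) :
  measurable_fin g -> measurable (g @^-1` A).
Proof.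
move=> mg; have -> : g @^-1` A = \bigcup_(x in A) g @^-1` [set x].
  by apply/seteqP; split=> w /=; [move=> Ag; exists (g w)|move=> [x Ax ->]].
by apply: fin_bigcup_measurable => //; exact: finite_finset.
Qed.

Lemma measurable_fin_comp (F G : finType) (h : F -> G) (g : T -> F) :
  measurable_fin g -> measurable_fin (fun w => h (g w)).
Proof. by move=> mg x; exact: (measurable_fin_preimage (h @^-1` [set x]) mg). Qed.

Lemma measurable_fin_cst (F : finType) (x : F) : measurable_fin (fun _ : T => x).
Proof.
by move=> y; rewrite (_ : _ @^-1` _ = cst x @^-1` [set y])// preimage_cst; case: ifP.
Qed.

(** Measurability of [h x] is asked only at values [x] that [g] attains. This matters because a step
    started from an arbitrary state could read entries outside the corner under consideration. *)
Lemma measurable_fin_bind (F G : finType) (g : T -> F) (h : F -> T -> G) :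
  measurable_fin g -> (forall w, measurable_fin (h (g w))) ->
  measurable_fin (fun w => h (g w) w).
Proof.
move=> mg mh y.
rewrite (_ : _ @^-1` _ = \bigcup_(x in range g)
    (g @^-1` [set x] `&` h x @^-1` [set y])); last first.
  apply/seteqP; split=> w /=; first by move=> <-; exists (g w) => //; exists w.
  by move=> [_ [w' _ <-]] [/= -> ->].
apply: fin_bigcup_measurable; first exact: finite_finset.
by move=> _ [w _ <-]; apply: measurableI; [exact: mg|exact: mh].
Qed.

Lemma measurable_fin_set (F : finType) (b : F -> T -> bool) :
  (forall x, measurable_fin (b x)) ->
  measurable_fin (fun w => [set x | b x w]%SET).
Proof.
move=> mb S; rewrite (_ : _ @^-1` _ = \bigcap_(x in [set: F])
    (b x @^-1` [set x \in S])); last first.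
  apply/seteqP; split=> w /=; first by move=> <- x _ /=; rewrite inE.
  by move=> bS; apply/setP => x; rewrite inE; exact: bS.
by apply: fin_bigcap_measurable => [|x _]; [exact: finite_finset|exact: mb].
Qed.

Lemma measurable_fin_forall (F : finType) (b : F -> T -> bool) :
  (forall x, measurable_fin (b x)) ->
  measurable_fin (fun w => [forall x, b x w]).
Proof.
move=> mb; rewrite (_ : (fun w => _) = fun w => [set x | b x w]%SET == finset.setT).
  exact: (measurable_fin_comp (fun A => A == finset.setT) (measurable_fin_set mb)).
apply/funext => w; apply/forallP/eqP => [bw|bw x].
  by apply/setP => x; rewrite !inE bw.
by move/setP: bw => /(_ x); rewrite !inE.
Qed.

Lemma measurable_fin_le (R : realType) (f g : T -> R) :
  measurable_fun [set: T] f -> measurable_fun [set: T] g ->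
  measurable_fin (fun w => f w <= g w).
Proof.
move=> mf mg b; have mb : measurable [set b : bool] by [].
by have := measurable_fun_ler mf mg measurableT mb; rewrite setTI.
Qed.

End FiniteValued.

Section Adaptive.
Context {R : realType} d (T : measurableType d) (P : probability T R).
Context (I : finType) (X : I -> {RV P >-> R}).
Hypothesis iX : mutually_independent X.

(* The event [E] may be selected by [S] at no cost, because [S] only looks at
   variables on which the selected event does not depend. *)
Lemma adaptive_event (F : finType) (S : T -> F) (D : {set I})
    (D' : F -> {set I}) (E : F -> set T) (r : R) :
  (forall x, <<s cylinders X D >> (S @^-1` [set x])) ->
  (forall w, [disjoint D & D' (S w)]%B) ->
  (forall w, <<s cylinders X (D' (S w)) >> (E (S w))) ->
  (forall w, (P (E (S w)) <= r%:E)%E) ->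
  measurable [set w | E (S w) w] /\ (P [set w | E (S w) w] <= r%:E)%E.
Proof.
move=> mS DD' mE PE.
have mS' x : measurable (S @^-1` [set x]) by exact: sigma_cylinders_measurable (mS x).
have mSE x : range S x -> measurable (S @^-1` [set x] `&` E x).
  move=> [w _ <-]; apply: measurableI => //.
  exact: sigma_cylinders_measurable (mE w).
have -> : [set w | E (S w) w] = \bigcup_(x in range S) (S @^-1` [set x] `&` E x).
  apply/seteqP; split=> w /=; first by move=> ES; exists (S w) => //; exists w.
  by move=> [_ [w' _ <-]] [/= ->].
have mU : measurable (\bigcup_(x in range S) (S @^-1` [set x] `&` E x)).
  by apply: fin_bigcup_measurable => //; exact: finite_finset.
split=> //.
have fin_range : finite_set (range S) by exact: finite_finset.
rewrite measure_fin_bigcup//=; last first.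
  by apply/trivIsetP => x y _ _ xy; rewrite -subset0 => w [[/= -> _] [/= E1 _]]; rewrite E1 eqxx in xy.
apply: (@le_trans _ _ (\sum_(x \in range S) r%:E * P (S @^-1` [set x]))%E).
  (* Each piece factors by independence; the probabilities of the fibres of [S] then add up to 1. *)
  apply: lee_fsum => // x [w _ <-].
  rewrite (indep_sigma_cylinders (D1 := D) (D2 := D' (S w)) iX)//.
  by rewrite muleC lee_wpmul2r.
rewrite -ge0_mule_fsumr//.
rewrite -measure_fin_bigcup//; last first.
  by apply/trivIsetP => x y _ _ xy; rewrite -subset0 => w [/= -> E1]; rewrite E1 eqxx in xy.
rewrite (_ : \bigcup_(x in range S) _ = setT); last first.
  by apply/seteqP; split=> // w _; exists (S w) => //; exists w.
by rewrite [X in (_ * X)%E](probability_setT P) mule1.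
Qed.

End Adaptive.

(* For nonempty [L]: the maximum over [j] in [L] of the sum of [x] over [c j]
   is not in [lo, hi]. *)
Definition max_outside (R : realType) (I J : finType) (L : {set J})
    (c : J -> {set I}) (lo hi : R) (x : I -> R) : bool :=
  [exists j in L, hi < \sum_(p in c j) x p] ||
  [forall j in L, \sum_(p in c j) x p < lo].

Section LineMax.
Context {R : realType} d (T : measurableType d) (P : probability T R).
Context (I : finType) (X : I -> {RV P >-> R}).
Hypothesis iX : mutually_independent X.
Hypothesis nX : forall i, standard_normal (X i).
Variables (J : finType) (L : {set J}) (c : J -> {set I}).

Lemma max_outsideE lo hi :
  [set w | max_outside L c lo hi (X ^~ w)] =
  (\bigcup_(j in [set` L]) ((fun w => \sum_(p in c j) X p w) @^-1` [set y | hi < y]))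
  `|` (\bigcap_(j in [set` L]) ((fun w => \sum_(p in c j) X p w) @^-1` [set y | y < lo])).
Proof.
apply/seteqP; split=> w /=.
  by case/orP => [/exists_inP[j jL lt]|/forall_inP H]; [left; exists j|right].
case=> [[j /= jL lt]|H]; apply/orP; [left|right].
  by apply/exists_inP; exists j.
by apply/forall_inP.
Qed.

Let mgt hi : measurable [set y : R | hi < y].
Proof. by rewrite -set_itvoy; exact: measurable_itv. Qed.

Let mlt lo : measurable [set y : R | y < lo].
Proof. by rewrite -set_itvNyo; exact: measurable_itv. Qed.

Lemma sigma_max_outside lo hi :
  <<s cylinders X (\bigcup_(j in L) c j)%SET >>
    [set w | max_outside L c lo hi (X ^~ w)].
Proof.
have sB j (B : set R) : j \in L -> measurable B ->
    <<s cylinders X (\bigcup_(j in L) c j)%SET >>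
      ((fun w => \sum_(p in c j) X p w) @^-1` B).
  move=> jL mB; apply: (@sigma_cylindersS _ _ _ _ _ X (c j)).
    exact: finset.bigcup_sup.
  exact: sigma_cylinders_sum.
rewrite max_outsideE.
suff : measurable ((\bigcup_(j in [set` L]) ((fun w => \sum_(p in c j) X p w) @^-1` [set y | hi < y]))
  `|` (\bigcap_(j in [set` L]) ((fun w => \sum_(p in c j) X p w) @^-1` [set y | y < lo])) :
  set (g_sigma_algebraType (cylinders X (\bigcup_(j in L) c j)%SET))) by [].
apply: measurableU.
- by apply: fin_bigcup_measurable => [|j jL]; [exact: finite_finset|exact: sB].
- by apply: fin_bigcap_measurable => [|j jL]; [exact: finite_finset|exact: sB].
Qed.

(** Some sum above [hi] is a union bound over [L]. A maximum below [lo] forces all sums below [lo]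
    at once; they are independent because the sets are disjoint, whence the power of [p]. *)
Lemma prob_max_outside (l : nat) (lo hi q p : R) : (0 < l)%N ->
  (forall j, j \in L -> #|c j| = l) ->
  (forall j j', j \in L -> j' \in L -> j != j' -> [disjoint c j & c j']%B) ->
  (normal_prob 0 (Num.sqrt l%:R) [set y | (hi < y)%R] <= q%:E)%E ->
  (normal_prob 0 (Num.sqrt l%:R) [set y | (y < lo)%R] <= p%:E)%E ->
  (P [set w | max_outside L c lo hi (X ^~ w)] <=
   (#|L|%:R * q + p ^+ #|L|)%:E)%E.
Proof.
move=> l0 cl cdisj Hq Hp; rewrite max_outsideE.
have Psum j (B : set R) : j \in L -> measurable B ->
    P ((fun w => \sum_(p in c j) X p w) @^-1` B) = normal_prob 0 (Num.sqrt l%:R) B.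
  move=> jL mB; rewrite -(cl _ jL); apply: (sum_standard_normal iX nX) => //.
  by rewrite -card_gt0 cl.
have mS j (B : set R) : measurable B ->
    measurable ((fun w => \sum_(p in c j) X p w) @^-1` B).
  by move=> mB; apply: (@sigma_cylinders_measurable _ _ _ _ _ X (c j)); exact: sigma_cylinders_sum.
have p0 : 0 <= p by rewrite -lee_fin; apply: le_trans Hp.
set A := (X in X `|` _); set B := (X in _ `|` X).
have mA : measurable A.
  by apply: fin_bigcup_measurable => [|j jL]; [exact: finite_finset|exact: mS].
have mB : measurable B.
  by apply: fin_bigcap_measurable => [|j jL]; [exact: finite_finset|exact: mS].
apply: (@le_trans _ _ (P A + P B)%E); first exact: measureU2.
rewrite EFinD; apply: leeD.
- apply: (@le_trans _ _ (\sum_(j \in [set` L]) q%:E)%E).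
    have /le_trans := @content_sub_fsum _ _ _ P _ _ A _ (@finite_finset _ _)
      (fun j _ => mS j _ (mgt hi)) mA (@subset_refl _ A).
    apply.
    apply: lee_fsum; first exact: finite_finset.
    by move=> j jL; move: (Psum j _ jL (mgt hi)) Hq => /= -> .
  rewrite -(bigfs _ (index_enum_uniq J)); last by move=> j _; rewrite mem_index_enum.
  by rewrite sumEFin sumr_const mulr_natl.
- rewrite (indep_bigcap iX cdisj); last first.
    by move=> j jL; exact: sigma_cylinders_sum.
  rewrite -prodr_const -prodEFin.
  suff /andP[] : (0 <= \prod_(j in L) P ((fun w => (\sum_(p in c j) X p w)%R) @^-1` [set y | (y < lo)%R])
     <= \prod_(j in L) p%:E)%E by [].
  apply: (big_ind2 (fun x y => 0 <= x <= y)%E).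
  + by rewrite lexx lee_fin ler01.
  + move=> x1 x2 y1 y2 /andP[x1_ge0 x12] /andP[y1_ge0 y12].
    by rewrite mule_ge0//= lee_pmul.
  + by move=> j jL; rewrite measure_ge0/= Psum.
Qed.

End LineMax.

(** * The greedy procedure *)

Section IGPRun.
Context {R : realType} (n k : nat) (sel : {set 'I_n} -> {set 'I_n}).
Hypothesis k_gt0 : (0 < k)%N.
Hypothesis k_le_n : (k <= n)%N.
Hypothesis tie : tie_rule sel.
Variable I1 : {set 'I_n}.
Hypothesis I1P : singleton_in I1 (block n k 1).
Local Notation m := (n %/ k)%N.
Implicit Types (A : 'M[R]_n) (s : {set 'I_n} * {set 'I_n}).

(** Unlike the average, the sum is additive: each step adds exactly the sum over the new line. *)
Definition entry_sum A (D : {set 'I_n * 'I_n}) : R := \sum_(p in D) A p.1 p.2.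

Lemma Ave_entry_sum A (I J : {set 'I_n}) :
  Ave A I J = entry_sum A (finset.setX I J) / (#|I| * #|J|)%:R.
Proof.
rewrite /Ave /entry_sum pair_big /=; congr (_ / _).
by apply: eq_bigl => -[i j]; rewrite finset.in_setX.
Qed.

Lemma entry_sum_col A (I J : {set 'I_n}) j : j \notin J ->
  entry_sum A (finset.setX I (j |: J)) =
  entry_sum A (finset.setX I [set j]%SET) + entry_sum A (finset.setX I J).
Proof.
move=> jJ; rewrite /entry_sum -bigU/=; last first.
  apply/pred0P => -[a b] /=; rewrite !finset.in_setX !inE.
  by apply/negbTE/negP => /andP[/andP[_ /eqP ->] /andP[_]]; apply/negP.
by apply: eq_bigl => -[a b]; rewrite !finset.in_setX !inE -andb_orr.
Qed.

Lemma entry_sum_row A (I J : {set 'I_n}) i : i \notin I ->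
  entry_sum A (finset.setX (i |: I) J) =
  entry_sum A (finset.setX [set i]%SET J) + entry_sum A (finset.setX I J).
Proof.
move=> iI; rewrite /entry_sum -bigU/=; last first.
  apply/pred0P => -[a b] /=; rewrite !finset.in_setX !inE.
  by apply/negbTE/negP => /andP[/andP[/eqP -> _] /andP[iI' _]]; rewrite iI' in iI.
by apply: eq_bigl => -[a b]; rewrite !finset.in_setX !inE -andb_orl.
Qed.

Lemma mem_block l (x : 'I_n) :
  (x \in block n k l) = (l.-1 * m <= x < l * m)%N.
Proof. by rewrite inE ltnS. Qed.

Lemma block_width_gt0 : (0 < m)%N.
Proof. by rewrite divn_gt0. Qed.

Lemma block_end l : (l <= k)%N -> (l * m <= n)%N.
Proof. by move=> lk; apply: leq_trans (leq_divM n k); rewrite mulnC leq_mul2l lk orbT. Qed.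

Lemma card_block l : (0 < l)%N -> (l <= k)%N -> #|block n k l| = m.
Proof.
case: l => // l _ lk.
have lt i : (i < m -> l * m + i < n)%N.
  by move=> im; apply: leq_trans (block_end lk); rewrite mulSn [(m + _)%N]addnC ltn_add2l.
pose f (i : 'I_m) : 'I_n := Ordinal (lt i (ltn_ord i)).
rewrite -[RHS]card_ord -(card_imset _ (f := f)); last first.
  by move=> i j [] /eqP; rewrite eqn_add2l => /eqP/val_inj.
apply: eq_card => x; rewrite mem_block /=.
apply/idP/imsetP => [/andP[l1 l2]|[i _ ->]]; last first.
  by rewrite /= leq_addr mulSn [(m + _)%N]addnC ltn_add2l /=.
have xm : (x - l * m < m)%N by rewrite ltn_subLR// addnC -mulSn.
by exists (Ordinal xm) => //; apply: val_inj; rewrite /= subnKC.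
Qed.

Lemma tie_argmax (L : {set 'I_n}) (F : 'I_n -> R) : L != finset.set0 ->
  exists2 j, j \in L &
    sel [set j in L | [forall j' in L, F j' <= F j]]%SET = [set j]%SET /\
    forall j', j' \in L -> F j' <= F j.
Proof.
move=> /set0Pn[j0 j0L].
set S := [set j in L | _]%SET.
have S0 : S != finset.set0.
  case: (@arg_maxP _ _ _ j0 (fun j => j \in L) F j0L) => j jL jmax.
  by apply/set0Pn; exists j; rewrite inE jL /=; apply/forall_inP => j' /jmax.
have [j] := tie S0; rewrite inE => /andP[jL /forall_inP jmax] selj.
by exists j.
Qed.

(** All candidates have the same number of entries, so the best average is also the largest sum. In
    [row_stepP], [0 < #|s.2|] keeps this common denominator nonzero. *)
Lemma column_stepP A s l : #|s.1| = l -> (0 < l <= k)%N ->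
  exists2 j, j \in block n k l &
    column_step k sel A s = (s.1, j |: s.2) /\
    forall j', j' \in block n k l ->
      entry_sum A (finset.setX s.1 [set j']%SET) <= entry_sum A (finset.setX s.1 [set j]%SET).
Proof.
move=> cs /andP[l0 lk].
have L0 : block n k l != finset.set0.
  by rewrite -card_gt0 card_block// block_width_gt0.
have [j jL [selj jmax]] := tie_argmax (fun j => Ave A s.1 [set j]%SET) L0.
exists j => //; split; first by rewrite /column_step /best_columns cs selj finset.setUC.
move=> j' /jmax; rewrite !Ave_entry_sum !cards1 ler_pM2r// invr_gt0 ltr0n.
by rewrite cs muln1.
Qed.

Lemma row_stepP A s l : #|s.1| = l -> (0 < #|s.2|)%N -> (l < k)%N ->
  exists2 i, i \in block n k l.+1 &
    row_step k sel A s = (i |: s.1, s.2) /\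
    forall i', i' \in block n k l.+1 ->
      entry_sum A (finset.setX [set i']%SET s.2) <= entry_sum A (finset.setX [set i]%SET s.2).
Proof.
move=> cs s20 lk.
have L0 : block n k l.+1 != finset.set0.
  by rewrite -card_gt0 card_block// block_width_gt0.
have [j jL [selj jmax]] := tie_argmax (fun i => Ave A [set i]%SET s.2) L0.
exists j => //; split; first by rewrite /row_step /best_rows cs selj finset.setUC.
move=> j' /jmax; rewrite !Ave_entry_sum !cards1 ler_pM2r// invr_gt0 ltr0n.
by rewrite mul1n.
Qed.

(* [run_state A t] is reached after [t] full rounds, [run_mid A t] after the
   column step that follows. *)
Definition run_state A t :=
  iter t (row_step k sel A \o column_step k sel A) (I1, finset.set0).
Definition run_mid A t := column_step k sel A (run_state A t).

(** The bounds place every chosen index before the next block to be opened. Hence the next index is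
    new and its candidate entries are unread. *)
Definition in_corner a b s : Prop :=
  [/\ #|s.1| = a, #|s.2| = b, forall i, i \in s.1 -> (i < a * m)%N &
      forall j, j \in s.2 -> (j < b * m)%N].

Lemma in_corner_column A s t : (t < k)%N -> in_corner t.+1 t s ->
  in_corner t.+1 t.+1 (column_step k sel A s).
Proof.
move=> tk [s1 s2 Is Js].
have [|j jL [-> _]] := @column_stepP A s t.+1 s1; first exact: tk.
move: jL; rewrite mem_block/= => /andP[j1 j2].
split=> //=.
  by rewrite cardsU1 s2; case: (boolP (j \in s.2)) => // /Js; rewrite ltnNge j1.
move=> j'; rewrite !inE => /orP[/eqP->//|/Js j't].
by apply: leq_trans j't _; rewrite leq_mul2r leqnSn orbT.
Qed.

Lemma in_corner_row A s t : (t.+1 < k)%N -> in_corner t.+1 t.+1 s ->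
  in_corner t.+2 t.+1 (row_step k sel A s).
Proof.
move=> tk [s1 s2 Is Js].
have [|//|i iL [-> _]] := @row_stepP A s t.+1 s1; first by rewrite s2.
move: iL; rewrite mem_block/= => /andP[i1 i2].
split=> //=.
  by rewrite cardsU1 s1; case: (boolP (i \in s.1)) => // /Is; rewrite ltnNge i1.
move=> i'; rewrite !inE => /orP[/eqP->//|/Is i't].
by apply: leq_trans i't _; rewrite leq_mul2r leqnSn orbT.
Qed.

Lemma in_corner_state A t : (t < k)%N -> in_corner t.+1 t (run_state A t).
Proof.
elim: t => [_|t IH tk].
  case: I1P => x; rewrite mem_block => /andP[_ x1] I1E.
  rewrite /run_state /= I1E.
  split=> /=; rewrite ?cards1 ?cards0//; first by move=> i; rewrite !inE => /eqP ->.
  by move=> j; rewrite inE.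
have tk' := ltnW tk.
by apply: in_corner_row => //; apply: in_corner_column => //; exact: IH.
Qed.

Lemma in_corner_mid A t : (t < k)%N -> in_corner t.+1 t.+1 (run_mid A t).
Proof. by move=> tk; apply: in_corner_column => //; exact: in_corner_state. Qed.

(** After [t] rounds the state has [t.+1] rows, so the candidates lie in block [t.+1] and their sums
    have deviation sqrt (t + 1). The state is an argument so that it can be frozen in
    [adaptive_event]. For [row_fail] the block is [t.+2], but the length is still [t.+1]. *)
Definition column_fail lo hi A t s : bool :=
  max_outside (block n k t.+1) (fun j => finset.setX s.1 [set j]%SET)
    (lo * Num.sqrt t.+1%:R) (hi * Num.sqrt t.+1%:R) (fun p => A p.1 p.2).

Definition row_fail lo hi A t s : bool :=
  max_outside (block n k t.+2) (fun i => finset.setX [set i]%SET s.2)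
    (lo * Num.sqrt t.+1%:R) (hi * Num.sqrt t.+1%:R) (fun p => A p.1 p.2).

Lemma max_outsideN (K J : finType) (L : {set J}) (c : J -> {set K}) lo hi
    (x : K -> R) j : ~~ max_outside L c lo hi x -> j \in L ->
  (forall j', j' \in L -> \sum_(p in c j') x p <= \sum_(p in c j) x p) ->
  lo <= \sum_(p in c j) x p <= hi.
Proof.
rewrite negb_or negb_exists_in negb_forall_in => /andP[/forall_inP H1 /exists_inP[j' j'L H2]] jL jmax.
rewrite [_ <= hi]leNgt H1// andbT.
by apply: le_trans (jmax _ j'L); rewrite leNgt.
Qed.

Lemma column_sum lo hi A t : (t < k)%N ->
  ~~ column_fail lo hi A t (run_state A t) ->
  lo * Num.sqrt t.+1%:R <=
    entry_sum A (finset.setX (run_mid A t).1 (run_mid A t).2) -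
    entry_sum A (finset.setX (run_state A t).1 (run_state A t).2) <=
  hi * Num.sqrt t.+1%:R.
Proof.
move=> tk fail; have [s1 s2 Is Js] := in_corner_state A tk.
have [|j jL [E jmax]] := @column_stepP A (run_state A t) t.+1 s1; first exact: tk.
have jJ : j \notin (run_state A t).2.
  by apply/negP => /Js lt; move: jL; rewrite mem_block /= leqNgt lt.
rewrite [run_mid A t]E entry_sum_col// addrK.
exact: max_outsideN fail jL jmax.
Qed.

Lemma row_sum lo hi A t : (t.+1 < k)%N ->
  ~~ row_fail lo hi A t (run_mid A t) ->
  lo * Num.sqrt t.+1%:R <=
    entry_sum A (finset.setX (run_state A t.+1).1 (run_state A t.+1).2) -
    entry_sum A (finset.setX (run_mid A t).1 (run_mid A t).2) <=
  hi * Num.sqrt t.+1%:R.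
Proof.
move=> tk fail; have [s1 s2 Is Js] := in_corner_mid A (ltnW tk).
have [|//|i iL [E imax]] := @row_stepP A (run_mid A t) t.+1 s1; first by rewrite s2.
have iI : i \notin (run_mid A t).1.
  by apply/negP => /Is lt; move: iL; rewrite mem_block /= leqNgt lt.
rewrite [run_state A t.+1]E entry_sum_row// addrK.
exact: max_outsideN fail iL imax.
Qed.

Definition step_weight : R :=
  \sum_(t < k) Num.sqrt t.+1%:R + \sum_(t < k.-1) Num.sqrt t.+1%:R.

(** This part is deterministic: the increments of [entry_sum] telescope, first over the [k.-1] full
    rounds and then over the final column step. *)
Lemma Ave_IGP_bounds lo hi A :
  (forall t, (t < k)%N -> ~~ column_fail lo hi A t (run_state A t)) ->
  (forall t, (t.+1 < k)%N -> ~~ row_fail lo hi A t (run_mid A t)) ->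
  lo * step_weight <= Ave_IGP k sel A I1 * (k ^ 2)%:R <= hi * step_weight.
Proof.
move=> colok rowok.
have St t : (t < k)%N ->
    let w := \sum_(u < t) Num.sqrt u.+1%:R + \sum_(u < t) Num.sqrt u.+1%:R in
    lo * w <= entry_sum A (finset.setX (run_state A t).1 (run_state A t).2) <= hi * w.
  elim: t => [_|t IH tk] /=.
    by rewrite !big_ord0 addr0 !mulr0 /entry_sum big1 ?lexx// => -[i j]; rewrite finset.in_setX inE andbF.
  have tk' := ltnW tk.
  have /andP[a1 a2] := IH tk'.
  have /andP[b1 b2] := column_sum tk' (colok _ tk').
  have /andP[c1 c2] := row_sum tk (rowok _ tk).
  rewrite /= in c1 c2; rewrite !big_ord_recr /=; apply/andP; split; lra.
have kk : (k.-1 < k)%N by rewrite prednK.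
have /andP[a1 a2] := St _ kk.
have /andP[b1 b2] := column_sum kk (colok _ kk).
have [c1 c2 _ _] := in_corner_mid A kk.
have -> : Ave_IGP k sel A I1 * (k ^ 2)%:R =
    entry_sum A (finset.setX (run_mid A k.-1).1 (run_mid A k.-1).2).
  rewrite /Ave_IGP Ave_entry_sum -[IGP _ _ _ _]/(run_mid A k.-1) c1 c2 prednK// mulnn.
  by rewrite divfK// pnatr_eq0 -lt0n expn_gt0 k_gt0.
have -> : step_weight = \sum_(t < k.-1) Num.sqrt t.+1%:R +
    \sum_(t < k.-1) Num.sqrt t.+1%:R + Num.sqrt k.-1.+1%:R.
  by rewrite /step_weight -[in X in X + _](prednK k_gt0) big_ord_recr /=; ring.
by apply/andP; split; lra.
Qed.

End IGPRun.

(** * Measurability of the run and probability of a failing step *)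

Section IGPProbability.
Context {R : realType} (n k : nat) (sel : {set 'I_n} -> {set 'I_n}).
Hypothesis k_gt0 : (0 < k)%N.
Hypothesis k_le_n : (k <= n)%N.
Hypothesis tie : tie_rule sel.
Variable I1 : {set 'I_n}.
Hypothesis I1P : singleton_in I1 (block n k 1).
Local Notation m := (n %/ k)%N.
Local Notation state := ({set 'I_n} * {set 'I_n})%type.

Section Measurability.
Context d (T : measurableType d) (A : T -> 'M[R]_n).

Lemma measurable_Ave (I J : {set 'I_n}) :
  (forall i j, i \in I -> j \in J -> measurable_fun [set: T] (fun w => A w i j)) ->
  measurable_fun [set: T] (fun w => Ave (A w) I J).
Proof.
move=> mA; rewrite (_ : (fun w => _) =
    fun w => entry_sum (A w) (finset.setX I J) * (#|I| * #|J|)%:R^-1); last first.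
  by apply/funext => w; rewrite Ave_entry_sum.
apply: measurable_funM => //; apply: measurable_fun_sum_in => -[i j].
by rewrite finset.in_setX => /andP[]; exact: mA.
Qed.

Lemma measurable_fin_argmax (L : {set 'I_n}) (F : 'I_n -> T -> R) :
  (forall j, j \in L -> measurable_fun [set: T] (F j)) ->
  measurable_fin (fun w => [set j in L | [forall j' in L, F j' w <= F j w]]%SET).
Proof.
move=> mF; apply: measurable_fin_set => j.
have [jL|jL] := boolP (j \in L); last exact: measurable_fin_cst.
apply: measurable_fin_forall => j'.
have [j'L|j'L] := boolP (j' \in L); last exact: measurable_fin_cst.
by apply: measurable_fin_le; exact: mF.
Qed.

Lemma measurable_column_step (s : state) :
  (forall i j, i \in s.1 -> j \in block n k #|s.1| ->
     measurable_fun [set: T] (fun w => A w i j)) ->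
  measurable_fin (fun w => column_step k sel (A w) s).
Proof.
move=> mA; apply: (measurable_fin_comp (fun S => (s.1, s.2 :|: sel S))).
apply: (measurable_fin_argmax (F := fun j w => Ave (A w) s.1 [set j]%SET)) => j jL.
by apply: measurable_Ave => i j' iI; rewrite inE => /eqP ->; exact: mA.
Qed.

Lemma measurable_row_step (s : state) :
  (forall i j, i \in block n k #|s.1|.+1 -> j \in s.2 ->
     measurable_fun [set: T] (fun w => A w i j)) ->
  measurable_fin (fun w => row_step k sel (A w) s).
Proof.
move=> mA; apply: (measurable_fin_comp (fun S => (s.1 :|: sel S, s.2))).
apply: (measurable_fin_argmax (F := fun i w => Ave (A w) [set i]%SET s.2)) => i iL.
by apply: measurable_Ave => i' j; rewrite inE => /eqP -> jJ; exact: mA.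
Qed.

End Measurability.

Context d (T : measurableType d) (P : probability T R).
Variable C : 'I_n -> 'I_n -> {RV P >-> R}.
Hypothesis iidC : iid_standard_normal_mx C.
Let X (p : 'I_n * 'I_n) : {RV P >-> R} := C p.1 p.2.
Let A := mx_sample C.

Definition rect (a b : nat) : {set 'I_n * 'I_n} :=
  [set p : 'I_n * 'I_n | (p.1 < a * m)%N && (p.2 < b * m)%N]%SET.

Lemma rectS a b a' b' : (a <= a')%N -> (b <= b')%N -> rect a b \subset rect a' b'.
Proof.
move=> aa bb; apply/fintype.subsetP => p; rewrite !inE => /andP[pa pb].
by rewrite (leq_trans pa) ?(leq_trans pb)// leq_mul2r ?aa ?bb orbT.
Qed.

Lemma measurable_entry a b (i j : 'I_n) : (i < a * m)%N -> (j < b * m)%N ->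
  measurable_fun [set: g_sigma_algebraType (cylinders X (rect a b))]
    (fun w => A w i j).
Proof.
move=> ia jb; rewrite (_ : (fun w => _) = X (i, j)); last first.
  by apply/funext => w; rewrite /A mxE.
by apply: measurable_fun_cylinders; rewrite inE /= ia.
Qed.

(* Every step only reads entries whose row and column lie in blocks already
   opened, so the state is measurable for the entries of a corner of the matrix. *)
Lemma measurable_run t : (t < k)%N ->
  @measurable_fin _ (g_sigma_algebraType (cylinders X (rect t.+1 t))) _
    (fun w => run_state k sel I1 (A w) t) /\
  @measurable_fin _ (g_sigma_algebraType (cylinders X (rect t.+1 t.+1))) _
    (fun w => run_mid k sel I1 (A w) t).
Proof.
have mid u : (u < k)%N ->
  @measurable_fin _ (g_sigma_algebraType (cylinders X (rect u.+1 u))) _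
    (fun w => run_state k sel I1 (A w) u) ->
  @measurable_fin _ (g_sigma_algebraType (cylinders X (rect u.+1 u.+1))) _
    (fun w => run_mid k sel I1 (A w) u).
  move=> uk IH; apply: (measurable_fin_bind
    (T := g_sigma_algebraType (cylinders X (rect u.+1 u.+1)))
    (g := fun w => run_state k sel I1 (A w) u)
    (h := fun s w => column_step k sel (A w) s)).
    by move=> s; apply: (sigma_cylindersS (rectS (leqnn _) (leqnSn u))); exact: IH.
  move=> w; have [s1 _ Is _] := in_corner_state k_gt0 k_le_n tie I1P (A w) uk.
  apply: measurable_column_step => i j /Is iu; rewrite s1 mem_block => /andP[_ ju].
  exact: measurable_entry.
elim: t => [k0|t IH tk].
  have st0 : @measurable_fin _ (g_sigma_algebraType (cylinders X (rect 1 0))) _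
      (fun w => run_state k sel I1 (A w) 0) by exact: measurable_fin_cst.
  by split=> //; exact: mid.
have [_ IHmid] := IH (ltnW tk).
suff st : @measurable_fin _ (g_sigma_algebraType (cylinders X (rect t.+2 t.+1))) _
    (fun w => run_state k sel I1 (A w) t.+1) by split=> //; exact: mid.
apply: (measurable_fin_bind
  (T := g_sigma_algebraType (cylinders X (rect t.+2 t.+1)))
  (g := fun w => run_mid k sel I1 (A w) t)
  (h := fun s w => row_step k sel (A w) s)).
  by move=> s; apply: (sigma_cylindersS (rectS (leqnSn t.+1) (leqnn _))); exact: IHmid.
move=> w; have [s1 _ _ Js] := in_corner_mid k_gt0 k_le_n tie I1P (A w) (ltnW tk).
apply: measurable_row_step => i j; rewrite s1 mem_block => /andP[_ iu] /Js ju.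
exact: measurable_entry.
Qed.

Variables (lo hi q p : R).
Hypothesis hiq : forall l, (0 < l)%N ->
  (normal_prob 0 (Num.sqrt l%:R) [set y | (hi * Num.sqrt l%:R < y)%R] <= q%:E)%E.
Hypothesis lop : forall l, (0 < l)%N ->
  (normal_prob 0 (Num.sqrt l%:R) [set y | (y < lo * Num.sqrt l%:R)%R] <= p%:E)%E.

(** The state is determined by the corner [rect t.+1 t], whose columns stop just before block
    [t.+1], so [adaptive_event] applies. Since the thresholds scale with the deviation, the same [q]
    and [p] serve every step. In [prob_row_fail] the rows play this part. *)
Lemma prob_column_fail t : (t < k)%N ->
  let E := [set w | column_fail k lo hi (A w) t (run_state k sel I1 (A w) t)] in
  measurable E /\ (P E <= (m%:R * q + p ^+ m)%:E)%E.
Proof.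
move=> tk; have [iC nC] := iidC.
have failE s : [set w | column_fail k lo hi (A w) t s] =
    [set w | max_outside (block n k t.+1) (fun j => finset.setX s.1 [set j]%SET)
      (lo * Num.sqrt t.+1%:R) (hi * Num.sqrt t.+1%:R) (X ^~ w)].
  apply/seteqP; split=> w; rewrite /= /column_fail;
    by rewrite (_ : (fun p => A w p.1 p.2) = X ^~ w)//; apply/funext => p0; rewrite /A mxE.
apply: (adaptive_event iC (D := rect t.+1 t)
  (S := fun w => run_state k sel I1 (A w) t)
  (D' := fun s => (\bigcup_(j in block n k t.+1) finset.setX s.1 [set j])%SET)
  (E := fun s => [set w | column_fail k lo hi (A w) t s])).
- by move=> s; exact: (measurable_run tk).1.
- move=> w; apply/bigcup_disjointP => j; rewrite mem_block => /andP[tj _].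
  apply/pred0P => -[a b] /=; rewrite finset.in_setX !inE /=.
  by apply/negP => /andP[/andP[_ bt] /andP[_ /eqP bj]]; rewrite bj ltnNge tj in bt.
- by move=> w; rewrite failE; exact: sigma_max_outside.
- move=> w; rewrite failE; have [s1 _ _ _] := in_corner_state k_gt0 k_le_n tie I1P (A w) tk.
  rewrite -(@card_block n k t.+1)//.
  apply: (prob_max_outside iC (fun ij => nC ij.1 ij.2) (l := t.+1)) => //.
  + by move=> j _; rewrite cardsX cards1 s1 muln1.
  + move=> j j' _ _ jj'; apply/pred0P => -[a b] /=; rewrite !finset.in_setX !inE.
    by apply/negP => /andP[/andP[_ /eqP ->] /andP[_]]; apply/negP.
  + exact: hiq.
  + exact: lop.
Qed.

Lemma prob_row_fail t : (t.+1 < k)%N ->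
  let E := [set w | row_fail k lo hi (A w) t (run_mid k sel I1 (A w) t)] in
  measurable E /\ (P E <= (m%:R * q + p ^+ m)%:E)%E.
Proof.
move=> tk; have [iC nC] := iidC.
have failE s : [set w | row_fail k lo hi (A w) t s] =
    [set w | max_outside (block n k t.+2) (fun i => finset.setX [set i]%SET s.2)
      (lo * Num.sqrt t.+1%:R) (hi * Num.sqrt t.+1%:R) (X ^~ w)].
  apply/seteqP; split=> w; rewrite /= /row_fail;
    by rewrite (_ : (fun p => A w p.1 p.2) = X ^~ w)//; apply/funext => p0; rewrite /A mxE.
apply: (adaptive_event iC (D := rect t.+1 t.+1)
  (S := fun w => run_mid k sel I1 (A w) t)
  (D' := fun s => (\bigcup_(i in block n k t.+2) finset.setX [set i] s.2)%SET)
  (E := fun s => [set w | row_fail k lo hi (A w) t s])).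
- by move=> s; exact: (measurable_run (ltnW tk)).2.
- move=> w; apply/bigcup_disjointP => i; rewrite mem_block => /andP[ti _].
  apply/pred0P => -[a b] /=; rewrite finset.in_setX !inE /=.
  by apply/negP => /andP[/andP[at_ _] /andP[/eqP ai _]]; rewrite ai ltnNge ti in at_.
- by move=> w; rewrite failE; exact: sigma_max_outside.
- move=> w; rewrite failE.
  have [_ s2 _ _] := in_corner_mid k_gt0 k_le_n tie I1P (A w) (ltnW tk).
  rewrite -(@card_block n k t.+2)//.
  apply: (prob_max_outside iC (fun ij => nC ij.1 ij.2) (l := t.+1)) => //.
  + by move=> i _; rewrite cardsX cards1 s2 mul1n.
  + move=> i i' _ _ ii'; apply/pred0P => -[a b] /=; rewrite !finset.in_setX !inE.
    by apply/negP => /andP[/andP[/eqP -> _] /andP[ai' _]]; rewrite ai' in ii'.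
  + exact: hiq.
  + exact: lop.
Qed.

(** A union bound over [k] column steps and [k.-1] row steps, rounded up to [2 * k]. The premise
    isolates the numerical estimate that holds when no step fails. *)
Lemma prob_Ave_IGP (c e : R) :
  (forall a, lo * step_weight k <= a * (k ^ 2)%:R <= hi * step_weight k ->
     `|a - c| <= e) ->
  ((1 - (2 * k)%:R * (m%:R * q + p ^+ m))%:E <=
   P [set w | (`|Ave_IGP k sel (A w) I1 - c| <= e)%R])%E.
Proof.
move=> det; set r := m%:R * q + p ^+ m.
set G := [set w | _].
have kk : (k.-1 < k)%N by rewrite prednK.
have mG : measurable G.
  pose h s w := `|Ave (A w) s.1 s.2 - c| <= e.
  rewrite (_ : G = (fun w => h (run_mid k sel I1 (A w) k.-1) w) @^-1` [set true])//.
  apply: measurable_fin_bind.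
    move=> s; apply: (@sigma_cylinders_measurable _ _ _ P _ X).
    exact: (measurable_run kk).2.
  move=> w; apply: measurable_fin_le => //.
  apply: measurableT_comp => //; apply: measurable_funB => //.
  apply: measurable_Ave => i j _ _; rewrite (_ : (fun w => _) = C i j)//.
  by apply/funext => w'; rewrite /A mxE.
pose Ec t := [set w | column_fail k lo hi (A w) t (run_state k sel I1 (A w) t)].
pose Er t := [set w | row_fail k lo hi (A w) t (run_mid k sel I1 (A w) t)].
(* The last round has no row step. *)
pose E (t : 'I_k) := Ec t `|` (if (t.+1 < k)%N then Er t else set0).
have r0 : 0 <= r.
  have [_ H] := prob_column_fail kk.
  by rewrite -lee_fin; apply: le_trans H.
have mE t : measurable (E t).
  apply: measurableU; first exact: (prob_column_fail (ltn_ord t)).1.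
  by case: ifP => // tk; exact: (prob_row_fail tk).1.
have PE t : (P (E t) <= (2 * r)%:E)%E.
  apply: (@le_trans _ _ (P (Ec t) + P (if (t.+1 < k)%N then Er t else set0))%E).
    apply: measureU2; first exact: (prob_column_fail (ltn_ord t)).1.
    by case: ifP => // tk; exact: (prob_row_fail tk).1.
  rewrite mulrDl !mul1r EFinD; apply: leeD.
    exact: (prob_column_fail (ltn_ord t)).2.
  by case: ifP => [tk|_]; [exact: (prob_row_fail tk).2|rewrite measure0].
have mU : measurable (\bigcup_(t in [set: 'I_k]) E t).
  by apply: fin_bigcup_measurable => //; exact: finite_finset.
have PU : (P (\bigcup_(t in [set: 'I_k]) E t) <= ((2 * k)%:R * r)%:E)%E.
  have /le_trans := @content_sub_fsum _ _ _ P _ _ _ E (@finite_finset _ [set: 'I_k])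
      (fun t _ => mE t) mU (@subset_refl _ _).
  apply.
  apply: (@le_trans _ _ (\sum_(t \in [set: 'I_k]) (2 * r)%:E)%E).
    by apply: lee_fsum => [|t _]; [exact: finite_finset|exact: PE].
  have -> : [set: 'I_k] = [set` predT] by apply/seteqP; split.
  rewrite -(bigfs _ (index_enum_uniq _)); last first.
    by move=> t _; rewrite mem_index_enum.
  by rewrite sumEFin sumr_const cardT size_enum_ord lee_fin natrM -mulr_natr; lra.
have UG : ~` (\bigcup_(t in [set: 'I_k]) E t) `<=` G.
  move=> w /= nU; apply: det.
  apply: (Ave_IGP_bounds k_gt0 k_le_n tie I1P).
    move=> t tk; apply/negP => F; apply: nU.
    by exists (Ordinal tk) => //; left.
  move=> t tk; apply/negP => F; apply: nU.
  by exists (Ordinal (ltnW tk)) => //; right => /=; rewrite tk.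
have PUG : (P (~` (\bigcup_(t in [set: 'I_k]) E t)) <= P G)%E.
  by apply: le_measure; rewrite ?inE//; exact: measurableC.
apply: le_trans PUG; rewrite probability_setC// EFinB.
by apply: leeB.
Qed.

End IGPProbability.

(** * Numerical estimates *)

Section Weights.
Context {R : realType}.
Implicit Types n k : nat.

Lemma sum_sqrt_bounds k (x : R) : x = Num.sqrt k%:R ->
  2 / 3 * (k%:R * x) <= \sum_(t < k) Num.sqrt t.+1%:R <= 2 / 3 * (k%:R * x) + x.
Proof.
move=> ->{x}; elim: k => [|k /andP[IH1 IH2]].
  by rewrite big_ord0 sqrtr0 !mulr0 addr0 lexx.
rewrite big_ord_recr /=.
set x := Num.sqrt k%:R in IH1 IH2 *; set y := Num.sqrt k.+1%:R.
have x0 : 0 <= x by exact: sqrtr_ge0.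
have y0 : 0 <= y by exact: sqrtr_ge0.
have x2 : k%:R = x ^+ 2 by rewrite sqr_sqrtr.
have y2 : k.+1%:R = y ^+ 2 by rewrite sqr_sqrtr.
have yx : y ^+ 2 = x ^+ 2 + 1 by rewrite -y2 -x2 natr1.
rewrite y2; rewrite x2 in IH1 IH2.
(* These are the inequalities 3 x^2 y <= 2 x^3 + y^3 and 3 x y^2 <= x^3 + 2 y^3. With y^2 = x^2 + 1
   they give the induction steps of the lower and of the upper bound. *)
have H1 : 0 <= (y - x) ^+ 2 * (y + 2 * x) by rewrite mulr_ge0 ?sqr_ge0// addr_ge0// mulr_ge0.
have H2 : 0 <= (y - x) ^+ 2 * (2 * y + x) by rewrite mulr_ge0 ?sqr_ge0// addr_ge0// mulr_ge0.
have E1 : (y - x) ^+ 2 * (y + 2 * x) = y ^+ 2 * y + 2 * (x ^+ 2 * x) - 3 * (x ^+ 2) * y by ring.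
have E2 : (y - x) ^+ 2 * (2 * y + x) = 2 * (y ^+ 2 * y) + x ^+ 2 * x - 3 * (y ^+ 2) * x by ring.
rewrite E1 in H1; rewrite E2 in H2.
have F1 : 3 * x ^+ 2 * y = 3 * (y ^+ 2 * y) - 3 * y by rewrite yx; ring.
have F2 : 3 * y ^+ 2 * x = 3 * (x ^+ 2 * x) + 3 * x by rewrite yx; ring.
by apply/andP; split; lra.
Qed.

(** The weight is twice the sum of [sum_sqrt_bounds] minus [x]: the missing row step recentres the
    error from [0, 2x] to [-x, x]. *)
Lemma step_weight_bounds k (x : R) : (0 < k)%N -> x = Num.sqrt k%:R ->
  `|step_weight k - 4 / 3 * (k%:R * x)| <= x /\
  0 <= (step_weight k : R) <= 3 * (k%:R * x).
Proof.
move=> k0 xE; have /andP[h1 h2] := sum_sqrt_bounds xE.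
have E : \sum_(t < k) Num.sqrt t.+1%:R =
    \sum_(t < k.-1) Num.sqrt t.+1%:R + x.
  by rewrite xE -[in LHS](prednK k0) big_ord_recr /= prednK.
have s0 : 0 <= \sum_(t < k.-1) Num.sqrt t.+1%:R :> R.
  by apply: sumr_ge0 => i _; exact: sqrtr_ge0.
have x0 : 0 <= x by rewrite xE sqrtr_ge0.
have x1 : x <= k%:R * x by rewrite ler_peMl// ler1n.
rewrite ler_norml /step_weight; split; apply/andP; split; lra.
Qed.

End Weights.

Section Estimates.
Context {R : realType}.
Variables (n k : nat).
Hypothesis k_gt0 : (0 < k)%N.
Hypothesis k_le_n : (k <= n)%N.
Let L : R := ln n%:R.
Hypothesis L_ge : 50 ^+ 2 <= L.
Let x : R := Num.sqrt k%:R.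
Let y : R := Num.sqrt L.
Let b : R := Num.sqrt (2 * L).
Let lam : R := ln L.
Let eps : R := lam / y.

Let L_gt0 : 0 < L. Proof. by apply: lt_le_trans L_ge; rewrite exprn_gt0. Qed.
Let n_gt0 : 0 < n%:R :> R. Proof. by rewrite ltr0n (leq_trans k_gt0). Qed.
Let x_ge1 : 1 <= x.
Proof. by rewrite /x -[leLHS]sqrtr1 ler_sqrt ?ler1n ?ltr0n. Qed.
Let x2 : k%:R = x ^+ 2. Proof. by rewrite sqr_sqrtr. Qed.
Let y2 : L = y ^+ 2. Proof. by rewrite sqr_sqrtr// ltW. Qed.
Let y_ge : 50 <= y.
Proof.
have -> : 50 = Num.sqrt (50 ^+ 2) :> R by rewrite sqrtr_sqr ger0_norm.
by rewrite ler_sqrt// ltW.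
Qed.
Let b2 : b ^+ 2 = 2 * y ^+ 2.
Proof. by rewrite -y2 sqr_sqrtr// mulr_ge0// ltW. Qed.
Let b_ge0 : 0 <= b. Proof. exact: sqrtr_ge0. Qed.
(** Rational bounds for sqrt 2, which turn the later comparisons of [b] with [y] into linear
    ones. *)
Let b_bounds : 14 / 10 * y <= b <= 15 / 10 * y.
Proof.
have y0 : 0 <= y by rewrite (le_trans _ y_ge).
have yy : 0 <= y ^+ 2 by rewrite sqr_ge0.
apply/andP; split; rewrite -(@ler_pXn2r _ 2) ?nnegrE ?mulr_ge0//.
- by rewrite exprMn b2 expr_div_n; lra.
- by rewrite exprMn b2 expr_div_n; lra.
Qed.

Let lam_ge1 : 1 <= lam.
Proof.
rewrite -[leLHS](expRK 1) ler_ln ?posrE ?expR_gt0//.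
(* From 1 - 1/2 <= exp (-1/2) one gets exp (1/2) <= 2, so e <= 4 <= L. *)
have := expR_ge1Dx (- (1 / 2) : R); have := expR_gt0 (1 / 2 : R) => e0.
rewrite expRN => h.
have e2 : expR (1 / 2) <= 2 :> R.
  have : (1 + - (1 / 2)) * expR (1 / 2) <= 1 :> R.
    by rewrite -[leRHS](mulVf (lt0r_neq0 e0)) ler_pM2r.
  lra.
have -> : 1 = 1 / 2 + 1 / 2 :> R by lra.
rewrite expRD; apply: (@le_trans _ _ (2 * 2)).
  by apply: ler_pM; rewrite ?expR_ge0.
by have := L_ge; lra.
Qed.

(** Here ln L = 2 ln y <= 2 y, and y >= 50 gives 2 y <= y^2 / 25. The factor 25 is what [fail_small]
    needs to absorb its quadratic terms. *)
Let lam_le : lam <= L / 25.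
Proof.
have : lam <= 2 * y.
  rewrite /lam y2 expr2 lnM ?posrE ?(lt_le_trans _ y_ge)//.
  have := @le_ln1Dx R (y - 1); rewrite (_ : 1 + (y - 1) = y); last by lra.
  move=> H; have {}H : ln y <= y - 1 by apply: H; have := y_ge; lra.
  by lra.
have : y * 50 <= y ^+ 2.
  by rewrite expr2 ler_pM2l ?y_ge// (lt_le_trans _ y_ge).
by rewrite y2; lra.
Qed.

Let targetE : 4 / 3 * Num.sqrt (2 * L / k%:R) = 4 / 3 * b / x.
Proof. by rewrite sqrtrM ?mulr_ge0 ?ltW// sqrtrV// mulrA. Qed.

Let ratioE : Num.sqrt (L / k%:R) = y / x.
Proof. by rewrite sqrtrM ?ltW// sqrtrV. Qed.

Let Ave_scale (a u v : R) : u <= a * (k ^ 2)%:R <= v ->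
  u / x ^+ 4 <= a <= v / x ^+ 4.
Proof.
have x40 : 0 < x ^+ 4 by rewrite exprn_gt0// (lt_le_trans _ x_ge1).
rewrite natrX x2 -exprM => /andP[u1 v1].
by rewrite ler_pdivrMr// ler_pdivlMr// u1.
Qed.

Lemma Ave_close_large (a : R) : L ^+ 2 <= k%:R ->
  - (2 * y) * step_weight k <= a * (k ^ 2)%:R <= 2 * y * step_weight k ->
  `|a - 4 / 3 * Num.sqrt (2 * L / k%:R)| <=
  20 * Num.max (k%:R^-1 * Num.sqrt (L / k%:R)) (lam / y).
Proof.
move=> kL /Ave_scale /andP[a1 a2].
have [_ /andP[w0 w1]] := step_weight_bounds k_gt0 (erefl x).
have x0 : 0 < x by rewrite (lt_le_trans _ x_ge1).
have y0 : 0 < y by rewrite (lt_le_trans _ y_ge).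
have xy : y ^+ 2 <= x.
  by rewrite -y2 -(@ler_pXn2r _ 2) ?nnegrE ?(ltW L_gt0) ?(ltW x0) // -x2.
have t0 : 0 <= lam / y by rewrite divr_ge0 ?(le_trans _ lam_ge1)// ltW.
have yx : y / x <= lam / y.
  rewrite ler_pdivlMr// mulrAC ler_pdivrMr//.
  by apply: (@le_trans _ _ (1 * x)); rewrite ?ler_pM2r ?lam_ge1// mul1r -expr2 xy.
have yx0 : 0 <= y / x by rewrite divr_ge0// ltW.
have W : 2 * y * step_weight k / x ^+ 4 <= 6 * (y / x).
  rewrite ler_pdivrMr ?exprn_gt0//.
  have -> : 6 * (y / x) * x ^+ 4 = 2 * y * (3 * (k%:R * x)).
    by rewrite x2; field; rewrite gt_eqF.
  by rewrite ler_pM2l// mulr_gt0.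
have bx : 4 / 3 * b / x <= 2 * (y / x).
  by rewrite mulrA ler_pM2r ?invr_gt0//; case/andP: b_bounds; lra.
have bx0 : 0 <= 4 / 3 * b / x by rewrite divr_ge0 ?mulr_ge0// ltW.
rewrite targetE.
apply: (@le_trans _ _ (20 * (lam / y))); last first.
  by rewrite ler_pM2l// le_max lexx orbT.
rewrite !mulNr in a1.
by rewrite ler_norml; apply/andP; split; lra.
Qed.

(** Each term of the maximum controls one error: the spread [4 * eps] of the step maxima contributes
    at most [12 * eps], and replacing the weight by its leading term 4/3 k x contributes at most 2 y
    / (k x). *)
Lemma Ave_close_small (a : R) :
  (b - 4 * eps) * step_weight k <= a * (k ^ 2)%:R <=
  (b + 4 * eps) * step_weight k ->
  `|a - 4 / 3 * Num.sqrt (2 * L / k%:R)| <=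
  20 * Num.max (k%:R^-1 * Num.sqrt (L / k%:R)) (lam / y).
Proof.
move=> /Ave_scale /andP[a1 a2].
have [w /andP[w0 w1]] := step_weight_bounds k_gt0 (erefl x).
have x0 : 0 < x by rewrite (lt_le_trans _ x_ge1).
have x40 : 0 < x ^+ 4 by rewrite exprn_gt0.
have y0 : 0 < y by rewrite (lt_le_trans _ y_ge).
have eps0 : 0 <= eps by rewrite divr_ge0 ?(le_trans _ lam_ge1)// ltW.
rewrite targetE ratioE -/eps.
set W : R := step_weight k in a1 a2 w w0 w1.
have eW : 4 * eps * W / x ^+ 4 <= 12 * eps.
  rewrite ler_pdivrMr//; apply: (@le_trans _ _ (12 * eps * (k%:R * x))).
    have -> : 12 * eps * (k%:R * x) = 4 * eps * (3 * (k%:R * x)) by ring.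
    by rewrite ler_wpM2l// mulr_ge0.
  apply: ler_wpM2l; first by rewrite mulr_ge0.
  rewrite x2 -exprSr.
  exact: ler_weXn2l.
have bW : `|b * W / x ^+ 4 - 4 / 3 * b / x| <= 2 * (k%:R^-1 * (y / x)).
  have -> : b * W / x ^+ 4 - 4 / 3 * b / x = b / x ^+ 4 * (W - 4 / 3 * (k%:R * x)).
    by rewrite x2; field; rewrite gt_eqF.
  have bx4 : 0 <= b / x ^+ 4 by rewrite divr_ge0// ltW.
  rewrite normrM ger0_norm//.
  apply: (@le_trans _ _ (b / x ^+ 4 * x)); first exact: ler_wpM2l.
  have -> : b / x ^+ 4 * x = b * (k%:R^-1 * x^-1) by rewrite x2; field; rewrite gt_eqF.
  have -> : 2 * (k%:R^-1 * (y / x)) = 2 * y * (k%:R^-1 * x^-1) by ring.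
  apply: ler_wpM2r; first by rewrite mulr_ge0 ?invr_ge0 ?ler0n// ltW.
  by case/andP: b_bounds; lra.
set z := Num.max _ _.
have z1 : k%:R^-1 * (y / x) <= z by rewrite le_max lexx.
have z2 : eps <= z by rewrite le_max lexx orbT.
move: bW; rewrite !ler_norml => /andP[b1 b2'].
rewrite mulrBl in a1; rewrite mulrDl in a2.
rewrite (mulrBl (x ^+ 4)^-1) in a1; rewrite (mulrDl _ _ (x ^+ 4)^-1) in a2.
by apply/andP; split; lra.
Qed.

Let m : nat := (n %/ k)%N.

Let expR_L : expR L = n%:R.
Proof. by rewrite /L lnK// posrE. Qed.

Let n_ge_L : L <= n%:R.
Proof.
have := @le_ln1Dx R (n%:R - 1); rewrite (_ : 1 + (n%:R - 1) = n%:R); last by ring.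
move=> H; have : L <= n%:R - 1 by apply: H; have := n_gt0; lra.
lra.
Qed.

Let km_le_n : k%:R * m%:R <= n%:R :> R.
Proof. by rewrite -natrM ler_nat mulnC leq_divM. Qed.

Let n_le_km : n%:R <= 2 * k%:R * m%:R :> R.
Proof.
have m0 : (0 < m)%N by rewrite divn_gt0.
rewrite -!natrM ler_nat [leqLHS](divn_eq n k) -/m -mulnA mul2n -addnn [(k * m)%N]mulnC.
by rewrite leq_add2l (leq_trans (ltnW (ltn_pmod n k_gt0)))// leq_pmull.
Qed.

Let m_gt0 : (0 < m)%N. Proof. by rewrite divn_gt0. Qed.

(** The threshold [2 * y] makes q = n^-2. As [m] may be as small as 1, the power is only bounded by
    q ^+ m <= q; the total is still at most 4 k m q <= 4 / n. *)
Lemma fail_large (q := expR (- ((2 * y) ^+ 2 / 2))) :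
  (2 * k)%:R * (m%:R * q + q ^+ m) <= 4 / L.
Proof.
have n0 := n_gt0.
have qE : q = n%:R^-1 * n%:R^-1.
  rewrite /q (_ : - ((2 * y) ^+ 2 / 2) = - L + - L); last by rewrite y2; field.
  by rewrite expRD expRN expR_L.
have q0 : 0 <= q by exact: expR_ge0.
have q1 : q <= 1 by rewrite /q -expR0 ler_expR oppr_le0 divr_ge0 ?sqr_ge0.
have qm : q ^+ m <= q by apply: ler_iXnr; rewrite ?q0.
have m1 : 1 <= m%:R :> R by rewrite ler1n.
have k0 : 0 <= k%:R :> R by [].
apply: (@le_trans _ _ (4 * (k%:R * m%:R * q))).
  apply: (@le_trans _ _ ((2 * k)%:R * (2 * (m%:R * q)))).
    apply: ler_wpM2l => //.
    have : 1 * q <= m%:R * q by apply: ler_wpM2r.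
    lra.
  by rewrite natrM; lra.
apply: (@le_trans _ _ (4 * (n%:R * q))).
  by apply: ler_wpM2l => //; apply: ler_wpM2r.
have -> : n%:R * q = n%:R^-1 by rewrite qE mulrA divff ?mul1r ?gt_eqF.
apply: ler_wpM2l => //.
by rewrite lef_pV2 ?posrE.
Qed.

(* Here [m q] and [p ^ m] are both at most [L ^ -4]: with b^2 = 2 L one has
   (b + 4 eps)^2 / 2 >= L + 4 lam and (b - 3 eps)^2 / 2 <= L - 4 lam. *)
Lemma fail_small (q := expR (- ((b + 4 * eps) ^+ 2 / 2)))
    (p := 1 - eps / 3 * expR (- ((b - 4 * eps + eps) ^+ 2 / 2))) :
  k%:R <= L ^+ 2 -> 0 <= p ->
  (2 * k)%:R * (m%:R * q + p ^+ m) <= 4 / L.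
Proof.
move=> kL p0; have n0 := n_gt0.
have y0 : 0 < y by rewrite (lt_le_trans _ y_ge).
have eps0 : 0 <= eps by rewrite divr_ge0 ?(le_trans _ lam_ge1)// ltW.
have epsy : eps * y = lam by rewrite divfK// gt_eqF.
have eb1 : 14 / 10 * lam <= b * eps.
  have /andP[bb _] := b_bounds.
  by rewrite -epsy mulrCA [b * eps]mulrC ler_wpM2l// .
have ee : eps ^+ 2 <= lam / 25.
  have : eps ^+ 2 * L <= lam / 25 * L.
    rewrite y2 -exprMn epsy -y2 expr2 mulrAC -mulrA ler_wpM2l ?(le_trans _ lam_ge1)//.
  by rewrite ler_pM2r.
have bb : b ^+ 2 = 2 * L by rewrite b2 y2.
have L4 : expR (4 * lam) = L ^+ 4.
  by rewrite /lam expRM_natl lnK ?posrE.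
have q_le : q <= (n%:R * L ^+ 4)^-1.
  rewrite -expR_L -L4 -expRD -expRN ler_expR lerN2.
  have -> : (b + 4 * eps) ^+ 2 / 2 = b ^+ 2 / 2 + 4 * (b * eps) + 8 * eps ^+ 2 by field.
  have := sqr_ge0 eps; rewrite bb; have := lam_ge1; lra.
have mq : m%:R * q <= (L ^+ 4)^-1.
  apply: (@le_trans _ _ (n%:R * (n%:R * L ^+ 4)^-1)).
    apply: ler_pM; rewrite ?expR_ge0 ?ler0n//.
    by rewrite ler_nat leq_div.
  by rewrite invfM mulrA divff ?mul1r// gt_eqF.
pose Q := eps / 3 * expR (- ((b - 4 * eps + eps) ^+ 2 / 2)).
have Q_ge : eps / 3 * (L ^+ 4 / n%:R) <= Q.
  apply: ler_wpM2l; first by rewrite divr_ge0.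
  rewrite -expR_L -L4 -expRN -expRD ler_expR.
  (* The cross term gains 3 * 1.4 = 4.2 times [lam] and the square loses at most 4.5 / 25 = 0.18
     times [lam], which leaves just over [4 * lam]. *)
  have -> : (b - 4 * eps + eps) ^+ 2 / 2 = b ^+ 2 / 2 - 3 * (b * eps) + 9 / 2 * eps ^+ 2 by field.
  rewrite bb; have := lam_ge1; lra.
have Qm : 4 * lam <= Q * m%:R.
  apply: (@le_trans _ _ (eps / 3 * (L ^+ 4 / n%:R) * m%:R)); last exact: ler_wpM2r.
  have L2 : 0 < L ^+ 2 by rewrite exprn_gt0.
  (* The bound k <= L^2 enters here, through n <= 2 k m. Of the factor L^4 it leaves L^2 / 2, so
     that Q m is at least lam * L * y / 6, far above [4 * lam]. *)
  have mn : (2 * L ^+ 2)^-1 <= m%:R / n%:R.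
    rewrite ler_pdivlMr// mulrC ler_pdivrMr ?mulr_gt0//.
    apply: le_trans n_le_km _; rewrite [leRHS]mulrC; apply: ler_wpM2r => //.
    by rewrite ler_pM2l.
  have -> : eps / 3 * (L ^+ 4 / n%:R) * m%:R = eps / 3 * L ^+ 4 * (m%:R / n%:R) by ring.
  apply: (@le_trans _ _ (eps / 3 * L ^+ 4 * (2 * L ^+ 2)^-1)); last first.
    apply: ler_wpM2l mn; apply: mulr_ge0; first by rewrite divr_ge0.
    by rewrite exprn_ge0// ltW.
  have -> : eps / 3 * L ^+ 4 * (2 * L ^+ 2)^-1 = eps * y * (L * y / 6).
    have -> : eps * y * (L * y / 6) = eps * L * y ^+ 2 / 6 by ring.
    by rewrite -y2; field; rewrite gt_eqF.
  rewrite epsy [leRHS]mulrC; apply: ler_wpM2r; first exact: le_trans lam_ge1.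
  have : 50 * 50 <= L * y.
    by apply: ler_pM => //; have := L_ge; lra.
  lra.
have pm : p ^+ m <= (L ^+ 4)^-1.
  (* 1 - Q <= exp (- Q), and Q m >= 4 ln L gives exp (- Q m) <= L^-4. *)
  apply: (@le_trans _ _ (expR (- Q) ^+ m)).
    by apply: lerXn2r; rewrite ?nnegrE ?expR_ge0//; exact: (expR_ge1Dx (- Q)).
  by rewrite -expRM_natl -L4 -expRN ler_expR mulrN lerN2 [leRHS]mulrC.
apply: (@le_trans _ _ (2 * L ^+ 2 * (2 * (L ^+ 4)^-1))).
  apply: ler_pM => //.
  - by rewrite addr_ge0 ?mulr_ge0 ?expR_ge0 ?exprn_ge0.
  - by rewrite natrM ler_pM2l.
  - lra.
have -> : 2 * L ^+ 2 * (2 * (L ^+ 4)^-1) = 4 / L * L^-1.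
  by field; rewrite gt_eqF.
rewrite ler_piMr ?divr_ge0 ?(ltW L_gt0)//.
rewrite invf_le1//; have := L_ge; lra.
Qed.

Lemma prob_Ave_IGP_close (sel : {set 'I_n} -> {set 'I_n}) (I1 : {set 'I_n})
    d (T : measurableType d) (P : probability T R) (C : 'I_n -> 'I_n -> {RV P >-> R}) :
  iid_standard_normal_mx C -> singleton_in I1 (block n k 1) -> tie_rule sel ->
  ((1 - 4 / L)%:E <=
   P [set w | (`| Ave_IGP k sel (mx_sample C w) I1 - 4 / 3 * Num.sqrt (2 * L / k%:R) |
      <= 20 * Num.max (k%:R^-1 * Num.sqrt (L / k%:R)) (lam / y))%R ])%E.
Proof.
move=> iid I1P tie.
have s0 l : (0 < l)%N -> 0 < Num.sqrt (l%:R : R) by move=> l0; rewrite sqrtr_gt0 ltr0n.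
have mgt c : measurable [set v : measurableTypeR R | c < v].
  by rewrite -set_itvoy; exact: measurable_itv.
have mlt c : measurable [set v : measurableTypeR R | v < c].
  by rewrite -set_itvNyo; exact: measurable_itv.
have y0 : 0 < y by rewrite (lt_le_trans _ y_ge).
have upper (a : R) l : 0 <= a -> (0 < l)%N ->
    (normal_prob 0 (Num.sqrt l%:R) [set v | (a * Num.sqrt l%:R < v)%R] <=
     (expR (- (a ^+ 2 / 2)))%:E)%E.
  move=> a0 l0; apply: normal_prob_tail_le; [exact: s0|exact: mgt|].
  by move=> v /= /ltW av; rewrite expr2 -mulrA ler_wpM2l.
have [kL|kL] := leP (L ^+ 2) k%:R.
  have := @prob_Ave_IGP R n k sel k_gt0 k_le_n tie I1 I1P d T P C iid
    (- (2 * y)) (2 * y) (expR (- ((2 * y) ^+ 2 / 2))) (expR (- ((2 * y) ^+ 2 / 2))).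
  move=> /(_ _ _ _ _ (fun a => @Ave_close_large a kL)) H.
  apply: le_trans (H _ _); last 2 first.
  - by move=> l l0; apply: upper => //; rewrite mulr_ge0// ltW.
  (* The lower tail is the same lemma with the negative parameter [- (2 * y)], which reverses the
     comparison. *)
  - move=> l l0; rewrite -[(2 * y) ^+ 2]sqrrN; apply: normal_prob_tail_le; [exact: s0|exact: mlt|].
    move=> v /= /ltW av; rewrite expr2 -mulrA.
    by rewrite ler_nM2l// oppr_lt0 mulr_gt0.
  by rewrite lee_fin lerB// fail_large.
have eps0 : 0 <= eps by rewrite divr_ge0 ?(le_trans _ lam_ge1)// ltW.
pose p := 1 - eps / 3 * expR (- ((b - 4 * eps + eps) ^+ 2 / 2)).
have lo0 : 0 <= b - 4 * eps.
  rewrite subr_ge0 /eps mulrA ler_pdivrMr//.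
  have /andP[bb _] := b_bounds.
  have := ler_wpM2r (ltW y0) bb; have : y * y = L by rewrite y2 expr2.
  have := lam_le; have := L_gt0; lra.
have lower l : (0 < l)%N ->
    (normal_prob 0 (Num.sqrt l%:R) [set v | (v < (b - 4 * eps) * Num.sqrt l%:R)%R] <= p%:E)%E.
  move=> l0; have := normal_prob_tail_ge (s0 _ l0) lo0 eps0.
  set a := (b - 4 * eps) * _ => H.
  have -> : [set v : measurableTypeR R | v < a] = ~` [set v | a <= v].
    by apply/seteqP; split=> v /=; [move=> va; apply/negP; rewrite -ltNge|move/negP; rewrite -ltNge].
  rewrite (probability_setC (normal_prob 0 (Num.sqrt l%:R))); last first.
    by rewrite -set_itvcy; exact: measurable_itv.
  by rewrite /p EFinB leeB.
(* [p] is nonnegative because it bounds a probability; this makes its powers monotone in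
   [fail_small]. *)
have p0 : 0 <= p by rewrite -lee_fin; apply: le_trans (lower 1 _).
have := @prob_Ave_IGP R n k sel k_gt0 k_le_n tie I1 I1P d T P C iid
  (b - 4 * eps) (b + 4 * eps) (expR (- ((b + 4 * eps) ^+ 2 / 2))) p.
move=> /(_ _ _ _ _ (fun a => @Ave_close_small a)) H.
apply: le_trans (H _ lower); last first.
  by move=> l l0; apply: upper => //; rewrite addr_ge0// mulr_ge0.
by rewrite lee_fin lerB// fail_small// ltW.
Qed.

End Estimates.

(** * Passage to the limit *)

Lemma cvg_ln_nat (R : realType) : (fun n : nat => ln n%:R : R) @ \oo --> +oo.
Proof.
apply/cvgryPge => A; near=> n.
have : expR A <= n%:R by near: n; exact: nbhs_infty_ger.
by move=> An; rewrite -[A]expRK ler_ln ?posrE ?expR_gt0// (lt_le_trans _ An) ?expR_gt0.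
Unshelve. all: by end_near. Qed.

Theorem theorem2p3 (R : realType) (f : nat -> R)
  (f_gt0 : forall n, 0 < f n)
  (f_littleo : f =o_\oo (fun n : nat => n%:R : R)) :
  exists2 M : R, 0 < M &
    forall (d : nat -> measure_display)
      (T : forall n : nat, measurableType (d n))
      (P : forall n : nat, probability (T n) R)
      (C : forall n : nat, 'I_n -> 'I_n -> {RV (P n) >-> R})
      (I1 : forall n : nat, nat -> {set 'I_n})
      (sel : forall n : nat, nat -> {set 'I_n} -> {set 'I_n}),
    (forall n : nat, iid_standard_normal_mx (C n)) ->
    (forall n k : nat, (0 < k <= n)%N -> singleton_in (I1 n k) (block n k 1)) ->
    (forall n k : nat, tie_rule (sel n k)) ->
    (fun n : nat => \big[Order.min/1%E]_(1 <= k < (Num.truncn (f n)).+1)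
       P n [set w |
         `| Ave_IGP k (sel n k) (mx_sample (C n) w) (I1 n k)
            - 4 / 3 * Num.sqrt (2 * ln n%:R / k%:R) |
         <= M * Num.max (k%:R^-1 * Num.sqrt (ln n%:R / k%:R))
                        (ln (ln n%:R) / Num.sqrt (ln n%:R)) ])
      @ \oo --> 1%E.
Proof.
(* The two regimes need 14 (small [k]) and 8 (large [k]); 20 covers both. *)
exists 20 => // d T P C I1 sel iid I1P tie.
have lnoo := @cvg_ln_nat R.
have lower : (fun n : nat => (1 - 4 / ln n%:R : R)%:E) @ \oo --> 1%E.
  apply: cvg_EFin; first by near=> n.
  rewrite -[X in _ --> X]subr0 -[X in _ - X](mulr0 4).
  apply: cvgB; first exact: cvg_cst.
  apply: cvgMr; apply/gtr0_cvgV0 => //.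
  near=> n.
  by near: n; exact: (cvgry_gt lnoo).
apply: (squeeze_cvge _ lower (cvg_cst 1%E)).
(* The default value 1 of the minimum is the upper bound of the squeeze. *)
near=> n; apply/andP; split; last exact: bigmin_le_id.
have L50 : 50 ^+ 2 <= ln n%:R :> R by near: n; exact: (cvgry_ge lnoo).
(* The little-o hypothesis with constant 1: eventually every [k] in the range is at most [n], so all
   blocks are nonempty. *)
have fn : f n <= n%:R.
  near: n.
  have /eqoP /(_ _ ltr01) := f_littleo.
  apply: filterS => n; rewrite mul1r ger0_norm ?(ltW (f_gt0 n))// ger0_norm//.
rewrite big_nat; apply: le_bigmin => [|k /andP[k0 kf]].
  rewrite lee_fin gerBl divr_ge0// (le_trans _ L50)//.
have kn : (k <= n)%N.
  rewrite -(@ler_nat R) (le_trans _ fn)//.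
  by rewrite -truncn_ge_nat ?(ltW (f_gt0 n)).
apply: prob_Ave_IGP_close => //.
by apply: I1P; rewrite k0.
Unshelve. all: by end_near. Qed.
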